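(* Suppose that there are constants $J\in[0,\infty)$ and $K,L,\mathcal R\in(0,\infty)$ such that (C1) $(x-y)\cdot(b(x)-b(y))\le J|x-y|^2$ for any $x,y\in\mathbb{R}^d$, (C2) $(x-y)\cdot(b(x)-b(y))\le-K|x-y|^2$ if $|x-y|\ge\mathcal R$, (C3) $|b(x)-b(y)|\le L|x-y|$ for any $x,y\in\mathbb{R}^d$, and that $|\hat x-\hat y|\le|x-y|$ for any $x,y\in\mathbb{R}^d$. Let $h_0=\frac1L\min\left(\frac KL,\frac12\right)$. Suppose that $a=0$ or $a\ge\sqrt h$, and let $$\rho_a(x,y)=a\,\mathbf 1_{x\ne y}+f_a(|x-y|),\qquad f_a(r)=\int_0^rg_a(s\wedge\mathcal R)\,ds,$$ with the decreasing function $g_a:[0,\mathcal R]\to\mathbb{R}$ specified in the context. Let $$c_1(0)=\frac14\min\left(K,\ \frac{2c_0}{\mathcal R^2+2\sqrt h\,\mathcal R+12h}\right),$$ $$c_1(a)=\frac14\min\left(\frac{K}{1+a/\mathcal R},\ \frac{2c_0}{\mathcal R^2+2(a+\sqrt h)\mathcal R},\ \frac{2p_0}{h}\right)\quad\text{for }a>0.$$ Then $g_a(0)=1$, $g_a(s)\in[\tfrac12,1]$ for any $s\in[0,\mathcal R]$, and $$a\,\mathbf 1_{x\ne y}+\tfrac12|x-y|\le\rho_a(x,y)\le a\,\mathbf 1_{x\ne y}+|x-y|\quad\text{for any }x,y\in\mathbb{R}^d;$$ and if $h\in(0,h_0)$, then $$\mathbb{E}_{x,y}[\rho_a(X',Y')]\le(1-c_1(a)h)\,\rho_a(x,y)\quad\text{for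 all }x,y\in\mathbb{R}^d.$$
   Context: $b:\mathbb{R}^d\to\mathbb{R}^d$ is a Lipschitz continuous vector field and $h>0$ a step size. For $x\in\mathbb{R}^d$ let $\hat x=x+hb(x)$. The Euler transition kernel is $p(x,\cdot)=N(\hat x,hI_d)$; $\phi_{m,hI}$ denotes the density of $N(m,hI_d)$. Coupling: for $x,y\in\mathbb{R}^d$ let $\hat e=(\hat x-\hat y)/|\hat x-\hat y|$ if $\hat x\ne\hat y$ and $\hat e=0$ otherwise. Under $\mathbb{P}_{x,y}$, let $Z\sim N(0,I_d)$ and $U\sim\mathrm{Unif}(0,1)$ be independent, and $$X'=\hat x+\sqrt h\,Z,\qquad Y'=\begin{cases}X'&\text{if }U\le\phi_{\hat y,hI}(X')/\phi_{\hat x,hI}(X'),\\ \hat y+\sqrt h\,(I_d-2\hat e\hat e^T)Z&\text{otherwise.}\end{cases}$$ Universal constants (with $\phi$ the standard normal density on $\mathbb{R}$): $$c_0=4\min\left(\int_0^{1/2}u^2(1-e^{u-1/2})\phi(u)\,du,\ (1-e^{-1})\int_0^{1/2}u^3\phi(u)\,du\right)\ge0.007,\qquad p_0=\int_1^\infty\phi(t)\,dt\ge0.15.$$ Definition of $g_a$. Let $\Phi(u)=u$ and $\underline\alpha(u)=c_0\min(u,\sqrt h)\sqrt h$ for $u>0$. Case $a=0$: let $I_r=(0,r+\sqrt h)$ for $r<\sqrt h$, $I_r=(r-\sqrt h,r)$ for $r\ge\sqrt h$, and $\hat I_s=\{r\in(0,\infty):s\in I_r\}$. Then $$g_0(u)=1-2c\int_0^u\sup_{\hat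 I_s}\frac{\Phi}{\underline\alpha}\,ds,\qquad c=\frac14\left(\int_0^{\mathcal R}\sup_{\hat I_s}\frac{\Phi}{\underline\alpha}\,ds\right)^{-1}.$$ Case $a>0$: let $\hat I_s=(\max(s,\sqrt h),s+\sqrt h)$. Then $$g_a(u)=1-2c\int_0^u\sup_{\hat I_s}\frac{a+\Phi}{\underline\alpha}\,ds,\qquad c=\min\left(\frac{p_0}2,\ \frac14\left(\int_0^{\mathcal R}\sup_{\hat I_s}\frac{a+\Phi}{\underline\alpha}\,ds\right)^{-1}\right).$$ *)

(* Defs.v *)
From HB Require Import structures.
From mathcomp Require Import all_boot all_order all_algebra.
From mathcomp Require Import all_classical all_reals all_analysis.

Set Implicit Arguments.
Unset Strict Implicit.
Unset Printing Implicit Defensive.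

Import Order.TTheory GRing.Theory Num.Theory.
Import numFieldNormedType.Exports.

Local Open Scope classical_set_scope.
Local Open Scope ring_scope.

(* R^d is 'cV[R]_d. The canonical norm `|x| on matrices is the sup norm, so the
   Euclidean structure is introduced here. *)
Definition dotp (R : realType) (d : nat) (x y : 'cV[R]_d) : R :=
  (x^T *m y) 0 0.

Definition enorm (R : realType) (d : nat) (x : 'cV[R]_d) : R :=
  Num.sqrt (dotp x x).

(* hat x = x + h b(x) *)
Definition euler (R : realType) (d : nat) (h : R) (b : 'cV[R]_d -> 'cV[R]_d)
    (x : 'cV[R]_d) : 'cV[R]_d :=
  x + h *: b x.

(* Density of N(m, v I_d) with respect to Lebesgue measure on R^d. *)
Definition gauss_pdf (R : realType) (d : nat) (m : 'cV[R]_d) (v : R)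
    (z : 'cV[R]_d) : R :=
  ((2 * pi * v) `^ (d%:R / 2))^-1 * expR (- enorm (z - m) ^+ 2 / (2 * v)).

Definition unit_dir (R : realType) (d : nat) (u v : 'cV[R]_d) : 'cV[R]_d :=
  if u != v then (enorm (u - v))^-1 *: (u - v) else 0.

Definition couplingX (R : realType) (d : nat) (h : R)
    (b : 'cV[R]_d -> 'cV[R]_d) (x z : 'cV[R]_d) : 'cV[R]_d :=
  euler h b x + Num.sqrt h *: z.

Definition couplingY (R : realType) (d : nat) (h : R)
    (b : 'cV[R]_d -> 'cV[R]_d) (x y z : 'cV[R]_d) (u : R) : 'cV[R]_d :=
  let hx := euler h b x in
  let hy := euler h b y in
  let e := unit_dir hx hy in
  let x' := couplingX h b x z in
  if u <= gauss_pdf hy h x' / gauss_pdf hx h x' then x'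
  else hy + Num.sqrt h *: ((1%:M - 2 *: (e *m e^T)) *m z).

(* Random vectors take values in d.-tuple R, which carries the product
   (i.e. Borel) sigma-algebra. *)
Definition cvec (R : realType) (d : nat) (t : d.-tuple R) : 'cV[R]_d :=
  \col_i tnth t i.

(* Z ~ N(0, I_d): the law of Z is the d-fold product of N(0,1), which is
   determined by its values on measurable boxes. *)
Definition std_gaussian (R : realType) (d : nat) (disp : measure_display)
    (T : measurableType disp) (P : probability T R)
    (Z : {RV P >-> d.-tuple R}) : Prop :=
  forall A : 'I_d -> set R, (forall i, measurable (A i)) ->
    distribution P Z [set t | forall i, A i (tnth t i)] =
    (\prod_(i < d) normal_prob 0 1 (A i))%E.

Definition uniform01 (R : realType) (disp : measure_display)
    (T : measurableType disp) (P : probability T R)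
    (U : {RV P >-> R}) : Prop :=
  forall A : set R, measurable A ->
    distribution P U A = uniform_prob (@ltr01 R) A.

Definition independent_RVs (R : realType) (disp dX dY : measure_display)
    (T : measurableType disp) (TX : measurableType dX)
    (TY : measurableType dY) (P : probability T R)
    (X : {RV P >-> TX}) (Y : {RV P >-> TY}) : Prop :=
  forall (A : set TX) (B : set TY), measurable A -> measurable B ->
    P (X @^-1` A `&` Y @^-1` B) = (P (X @^-1` A) * P (Y @^-1` B))%E.

Definition c0 (R : realType) : R :=
  let phi : R -> R := normal_pdf 0 1 in
  4 * Num.min
    (\int[lebesgue_measure]_(u in `[0, 2^-1])
       (u ^+ 2 * (1 - expR (u - 2^-1)) * phi u))
    ((1 - expR (-1)) *
       \int[lebesgue_measure]_(u in `[0, 2^-1]) (u ^+ 3 * phi u)).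

Definition p0 (R : realType) : R :=
  \int[lebesgue_measure]_(t in `[1, +oo[) (normal_pdf 0 1 t : R).

Definition Phi (R : realType) (u : R) : R := u.

Definition alpha_low (R : realType) (h u : R) : R :=
  c0 R * Num.min u (Num.sqrt h) * Num.sqrt h.

Definition I0 (R : realType) (h r : R) : set R :=
  if r < Num.sqrt h then `]0, r + Num.sqrt h[%classic
  else `]r - Num.sqrt h, r[%classic.

Definition Ihat (R : realType) (h a s : R) : set R :=
  if a == 0 then [set r | 0 < r /\ I0 h r s]
  else `]Num.max s (Num.sqrt h), s + Num.sqrt h[%classic.

(* For s > 0 the set is nonempty and bounded, so sup is the true supremum. *)
Definition sup_ratio (R : realType) (h a s : R) : R :=
  sup [set (a + Phi r) / alpha_low h r | r in Ihat h a s].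

Definition int_ratio (R : realType) (h a u : R) : R :=
  \int[lebesgue_measure]_(s in `[0, u]) sup_ratio h a s.

Definition c_const (R : realType) (h calR a : R) : R :=
  if a == 0 then 4^-1 * (int_ratio h a calR)^-1
  else Num.min (p0 R / 2) (4^-1 * (int_ratio h a calR)^-1).

Definition g_fun (R : realType) (h calR a u : R) : R :=
  1 - 2 * c_const h calR a * int_ratio h a u.

Definition f_fun (R : realType) (h calR a r : R) : R :=
  \int[lebesgue_measure]_(s in `[0, r]) g_fun h calR a (Num.min s calR).

Definition rho (R : realType) (d : nat) (h calR a : R) (x y : 'cV[R]_d) : R :=
  a * (x != y)%:R + f_fun h calR a (enorm (x - y)).

Definition h0 (R : realType) (K L : R) : R := L^-1 * Num.min (K / L) 2^-1.

Definition c1 (R : realType) (h K calR a : R) : R :=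
  if a == 0 then
    4^-1 * Num.min K
      (2 * c0 R / (calR ^+ 2 + 2 * Num.sqrt h * calR + 12 * h))
  else
    4^-1 * Num.min (K / (1 + a / calR))
      (Num.min (2 * c0 R / (calR ^+ 2 + 2 * (a + Num.sqrt h) * calR))
               (2 * p0 R / h)).

(* Main.v *)
Require Import Defs.
From HB Require Import structures.
From mathcomp Require Import all_boot all_order all_algebra.
From mathcomp Require Import all_classical all_reals all_analysis.
From mathcomp Require Import measurable_realfun ring lra.

Set Implicit Arguments.
Unset Strict Implicit.
Unset Printing Implicit Defensive.

Import Order.TTheory GRing.Theory Num.Theory.
Import numFieldNormedType.Exports.

Local Open Scope classical_set_scope.
Local Open Scope ring_scope.

(** Why the Euler chains contract under the reflection coupling.

    Write [s] for [Num.sqrt h], [M] for [calR], [r] for the distance of [x]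
    and [y], and [rh] for the distance of [hat x] and [hat y].

    Reduction to one dimension.  Let [e] be the unit vector along
    [hat x - hat y] and [v] the component of [Z] along [e], which is a standard
    Gaussian ([gaussian_projection]).  The Householder matrix flips only this
    component, so a rejected step leaves the two chains on a line of direction
    [e], at distance [rh + 2 * s * v], and the acceptance ratio is a function
    of [v] too.  Integrating out the uniform variable, the expected cost is a
    Gaussian integral on the line, weighted by the rejection probability
    [reject (rh / s) v] ([expectation_coupling]).

    The metric.  The supremum in the definition of [g_fun] can be computed, so
    that [g_fun] is quadratic on [0, M], and [f_fun] is cubic there and affine
    beyond ([bent_profile]).  It is concave, with slopes between 1/2 and 1,
    which gives the first three claims.

    The contraction.  The mass removed by acceptance is the mirror image of
    the Gaussian on the other side of 0, hence the distance after one step,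
    counted as 0 after an accepted step, has mean exactly [rh]
    ([gauss_mean_distance]).  By concavity the mean of [f_fun] is therefore at
    most its value at [rh], minus the mean defect of the tangent of [f_fun] at
    [rh] ([coupled_cost_bound]).  If [M <= r], this alone suffices, since [rh]
    is at most [(1 - h * K / 2) * r] ([euler_contraction]).  If [r < M], the
    step has to gain [c1 * h] times [a + rh], and there are three sources:

    - if [s <= rh], the fluctuations to the left of [rh] meet the bend of
      [f_fun]; their size is the first integral in [c0] ([step_le_below]);
    - if [rh < s] and [s <= a], the chains meet with probability at least
      [p0], which saves the jump [a] of the metric at 0 ([p0_le_accept]);
    - if [rh < s] and [a = 0], the fluctuations to the right of [rh] are
      measured by the second integral in [c0] ([step_le_above]).  They may
      leave the interval [0, M] on which [f_fun] bends, but only if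
      [M <= 2 * s].  In this regime either half of the bend still lies to the
      right of [rh], or [M / 2 < rh] and the defect of the tangent at 0,
      collected whenever the chains meet, is large enough
      ([step_le_coalescence]).  The term [12 * h] in [c1] absorbs the constants
      lost here ([c1_le_short_range]). *)

(** * Lebesgue measure under affine maps *)

(** The image measure with its measure structure, which [pushforward] carries
    only in the presence of a proof that the map is measurable. *)
Definition image_measure d d' (T1 : measurableType d) (T2 : measurableType d')
    (R : realType) (m : {measure set T1 -> \bar R}) (f : T1 -> T2)
    (mf : measurable_fun setT f) : {measure set T2 -> \bar R} :=
  measure_function_pushforward__canonical__measure_function_Measure m mf.

Lemma measurable_affine (R : realType) (a b : R) :
  measurable_fun [set: R] (fun x : R => a * x + b).
Proof. by apply: measurable_funD => //; apply: measurable_funM. Qed.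

(** Both sides are measures in [A], and they agree on half-open intervals. *)
Lemma lebesgue_measure_affine (R : realType) (a b : R) (A : set R) :
  a != 0 -> measurable A ->
  (lebesgue_measure ((fun x : R => a * x + b)%R @^-1` A) =
   `|a|^-1%:E * lebesgue_measure A)%E.
Proof.
move=> a0 mA.
have maff : measurable_fun [set: measurableTypeR R]
    ((fun x => a * x + b) : _ -> measurableTypeR R).
  exact: measurable_affine.
pose nu : {measure set (measurableTypeR R) -> \bar R} :=
  mscale (NngNum (normr_ge0 a)) (image_measure lebesgue_measure maff).
suff nuE : lebesgue_measure A = nu A.
  by rewrite nuE /nu /= /mscale /= muleA -EFinM mulVf ?normr_eq0// mul1e.
apply: lebesgue_measure_unique => // _ [[p q]] _ <- /=.
rewrite /nu /= /mscale/= /pushforward /=.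
have [an|ap] := ltP a 0.
  have -> : (fun x => a * x + b) @^-1` `]p, q] = `[(q - b) / a, (p - b) / a[%classic.
    apply/seteqP; split => x /=; rewrite !in_itv/= ler_ndivrMr// ltr_ndivlMr//.
    by rewrite lerBrDr ltrBlDr andbC mulrC.
    by rewrite lerBrDr ltrBlDr andbC mulrC.
  rewrite !lebesgue_measure_itv/= !lte_fin ltr_nM2r ?invr_lt0// ltrD2r.
  case: ifP => _; last by rewrite mule0.
  by rewrite -!EFinB -EFinM ltr0_norm//; congr EFin; field.
have {ap}ap : 0 < a by rewrite lt_neqAle eq_sym a0.
have -> : (fun x => a * x + b) @^-1` `]p, q] = `](p - b) / a, (q - b) / a]%classic.
  apply/seteqP; split => x /=; rewrite !in_itv/= ler_pdivlMr// ltr_pdivrMr//.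
  by rewrite lerBrDr ltrBlDr mulrC.
  by rewrite lerBrDr ltrBlDr mulrC.
rewrite !lebesgue_measure_itv/= !lte_fin ltr_pM2r ?invr_gt0// ltrD2r.
case: ifP => _; last by rewrite mule0.
by rewrite -!EFinB -EFinM gtr0_norm//; congr EFin; field.
Qed.

Lemma ge0_integral_affine (R : realType) (a b : R) (f : R -> \bar R) :
  a != 0 -> measurable_fun setT f -> (forall x, 0 <= f x)%E ->
  (\int[lebesgue_measure]_x f (a * x + b)%R =
   `|a|^-1%:E * \int[lebesgue_measure]_x f x)%E.
Proof.
move=> a0 mf f0.
have maff : measurable_fun [set: measurableTypeR R]
    ((fun x => a * x + b) : _ -> measurableTypeR R).
  exact: measurable_affine.
have ai0 : 0 <= `|a|^-1 by rewrite invr_ge0.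
transitivity (\int[image_measure lebesgue_measure maff]_x f x)%E.
  by rewrite ge0_integral_pushforward//; exact: measurable_funTS.
rewrite -[X in (X%:E * _)%E]/((NngNum ai0)%:num).
rewrite -ge0_integral_mscale//.
apply: eq_measure_integral => A mA _.
by rewrite /= /mscale/= /pushforward/= lebesgue_measure_affine.
Qed.

(** * Integration against a density *)

Import HBNNSimple.

(** The identity is the hypothesis for indicators; it passes to simple
    functions by linearity and to [f] by monotone convergence. *)
Lemma ge0_integral_density d (T : measurableType d) (R : realType)
    (mu nu : {measure set T -> \bar R}) (p : T -> R) :
  measurable_fun setT p -> (forall x, 0 <= p x) ->
  (forall A, measurable A -> nu A = \int[mu]_(x in A) (p x)%:E)%E ->
  forall f : T -> \bar R, measurable_fun setT f -> (forall x, 0 <= f x)%E ->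
  (\int[nu]_x f x = \int[mu]_x (f x * (p x)%:E))%E.
Proof.
move=> mp p0 nuE f mf f0.
have mpE : measurable_fun setT (EFin \o p) by exact/measurable_EFinP.
have nnE (g : {nnsfun T >-> R}) :
    (\int[nu]_x (g x)%:E = \int[mu]_x ((g x)%:E * (p x)%:E))%E.
  under [LHS]eq_integral do rewrite fimfunE -fsumEFin//.
  rewrite [LHS]ge0_integral_fsum//; last 2 first.
    - by move=> r; exact/measurable_EFinP/measurableT_comp.
    - by move=> n x _; rewrite EFinM nnfun_muleindic_ge0.
  transitivity (\int[mu]_x \sum_(r \in range g)
      ((r * \1_(g @^-1` [set r]) x)%:E * (p x)%:E))%E.
    rewrite [RHS]ge0_integral_fsum//; last 2 first.
      - move=> r; apply: emeasurable_funM => //.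
        exact/measurable_EFinP/measurableT_comp.
      - by move=> n x _; rewrite EFinM mule_ge0// ?nnfun_muleindic_ge0// lee_fin.
    apply: eq_fsbigr => r _.
    rewrite integralZl_indic_nnsfun//= integral_indic// setIT nuE//.
    under [RHS]eq_integral do rewrite EFinM -muleA.
    have [r0|r0] := ltP r 0.
      rewrite preimage_nnfun0// integral_set0 mule0.
      by rewrite integral0_eq// => x _; rewrite indic0 mul0e mule0.
    rewrite ge0_integralZl//; last 2 first.
      - by apply: emeasurable_funM => //; exact/measurable_EFinP/measurable_indic.
      - by move=> x _; rewrite mule_ge0// lee_fin.
    congr (_ * _)%E; rewrite integral_mkcond; apply: eq_integral => x _.
    rewrite patchE indicE; case: ifPn => xr; first by rewrite mul1e.
    by rewrite mul0e.
  apply: eq_integral => x _; rewrite [in RHS]fimfunE -fsumEFin//.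
  by rewrite ge0_mule_fsuml// => r; rewrite EFinM nnfun_muleindic_ge0.
pose f_ := nnsfun_approx measurableT mf.
have f_f x : (f_ n x)%:E @[n --> \oo] --> f x.
  by apply: cvg_nnsfun_approx => // *; exact: f0.
transitivity (lim (\int[nu]_x (f_ n x)%:E @[n --> \oo])%E).
  rewrite -monotone_convergence//=.
  - by apply: eq_integral => x _; apply/esym/cvg_lim => //; exact: f_f.
  - by move=> n; exact/measurable_EFinP/measurable_funTS.
  - by move=> n x _; rewrite lee_fin.
  - by move=> x _ a b ab; rewrite lee_fin; exact/lefP/nd_nnsfun_approx.
transitivity (lim (\int[mu]_x ((f_ n x)%:E * (p x)%:E) @[n --> \oo])%E).
  by apply: congr_lim; apply/funext => n /=; exact: nnE.
rewrite -monotone_convergence//=.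
- apply: eq_integral => x _; apply/cvg_lim => //.
  by apply: cvgeZr => //; exact: f_f.
- move=> n; apply: emeasurable_funM => //.
  exact/measurable_EFinP/measurable_funTS.
- by move=> n x _; rewrite mule_ge0// lee_fin.
- move=> x _ a b ab; rewrite lee_pmul// lee_fin//.
  exact/lefP/nd_nnsfun_approx.
Qed.

Lemma ge0_integral_normal_prob (R : realType) (m s : R) (f : R -> \bar R) :
  measurable_fun setT f -> (forall x, 0 <= f x)%E ->
  (\int[normal_prob m s]_x f x =
   \int[lebesgue_measure]_x (f x * (normal_pdf m s x)%:E))%E.
Proof.
move=> mf f0; apply: ge0_integral_density => //.
- exact: measurable_normal_pdf.
- exact: normal_pdf_ge0.
Qed.

(** * Sums of independent Gaussians *)

Lemma normal_pdf_std (R : realType) (m e t : R) : e != 0 ->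
  normal_pdf 0 1 ((t - m) / e) = `|e| * normal_pdf m `|e| t.
Proof.
move=> e0; have ne0 : `|e| != 0 by rewrite normr_eq0.
rewrite !normal_pdfE ?oner_eq0// /normal_peak /normal_fun.
rewrite mulrA; congr (_ * expR _).
  rewrite expr1n mul1r -mulrnAr sqrtrM ?sqr_ge0// sqrtr_sqr normr_id.
  by rewrite invfM mulrA mulfV// mul1r.
by rewrite subr0 expr1n real_normK ?num_real//; field.
Qed.

Lemma ge0_integral_std_normal_affine (R : realType) (m e : R) (f : R -> \bar R) :
  e != 0 -> measurable_fun setT f -> (forall x, 0 <= f x)%E ->
  (\int[normal_prob 0 1]_z f (e * z + m)%R = \int[normal_prob m `|e|%R]_t f t)%E.
Proof.
move=> e0 mf f0.
rewrite [LHS]ge0_integral_normal_prob//; last first.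
  by apply: measurableT_comp => //; exact: measurable_affine.
rewrite [RHS](ge0_integral_normal_prob _ _ mf f0).
have mg : measurable_fun setT (fun t : R => f t * (`|e| * normal_pdf m `|e| t)%:E)%E.
  apply: emeasurable_funM => //; apply/measurable_EFinP; apply: measurable_funM => //.
  exact: measurable_normal_pdf.
have g0 t : (0 <= f t * (`|e| * normal_pdf m `|e| t)%:E)%E.
  by rewrite mule_ge0// lee_fin mulr_ge0// normal_pdf_ge0.
transitivity (\int[lebesgue_measure]_x
    (fun t : R => f t * (`|e| * normal_pdf m `|e| t)%:E)%E (e * x + m)%R)%E.
  apply: eq_integral => x _; congr (_ * _%:E)%E.
  by rewrite -normal_pdf_std// addrK mulrC mulKf.
rewrite (ge0_integral_affine m e0 mg g0) -ge0_integralZl//.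
apply: eq_integral => x _; by rewrite muleCA -EFinM mulKf ?normr_eq0.
Qed.

(** Completing the square in [x]: up to the factor that depends on [t] alone,
    the product is again a normal density in [x], so integrating out [x] leaves
    the density of the sum. *)
Lemma normal_pdf_conv (R : realType) (s e x t : R) : e != 0 ->
  let sg := Num.sqrt (s ^+ 2 + e ^+ 2) in
  normal_pdf (s * x) `|e| t * normal_pdf 0 1 x =
  normal_pdf 0 sg t * normal_pdf (s * t / sg ^+ 2) (`|e| / sg) x.
Proof.
move=> e0 sg; have ne0 : `|e| != 0 by rewrite normr_eq0.
have se0 : 0 < s ^+ 2 + e ^+ 2.
  by rewrite ltr_wpDl ?sqr_ge0// lt_neqAle eq_sym sqrf_eq0 e0 sqr_ge0.
have sg0 : 0 < sg by rewrite sqrtr_gt0.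
have sgE : sg ^+ 2 = s ^+ 2 + e ^+ 2 by rewrite sqr_sqrtr// ltW.
have esg0 : `|e| / sg != 0 by rewrite mulf_neq0// invr_neq0// gt_eqF.
rewrite !normal_pdfE ?oner_eq0 ?(gt_eqF sg0)//.
rewrite mulrACA [RHS]mulrACA; congr (_ * _).
  have pk r : 0 < r -> normal_peak r = r^-1 * normal_peak (1 : R).
    move=> r0; rewrite /normal_peak expr1n mul1r -mulrnAr sqrtrM ?sqr_ge0//.
    by rewrite sqrtr_sqr gtr0_norm// invfM.
  rewrite !(pk `|e|) ?normr_gt0// !(pk sg)// (pk (`|e| / sg)) ?divr_gt0 ?normr_gt0//.
  by field; rewrite ?ne0 ?gt_eqF.
rewrite /normal_fun -!expRD; congr expR.
rewrite expr_div_n real_normK ?num_real// sgE !subr0 expr1n.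
by field; rewrite e0 gt_eqF.
Qed.

(** Stated for images of the standard Gaussian rather than for densities, so
    that degenerate coefficients are covered. *)
Lemma normal_prob_conv (R : realType) (s e : R) (A : set R) : measurable A ->
  ((normal_prob 0 1 \x normal_prob 0 1) [set p : R * R | A (s * p.1 + e * p.2)%R] =
  normal_prob 0 1 ((fun t => Num.sqrt (s ^+ 2 + e ^+ 2) * t)%R @^-1` A))%E.
Proof.
move=> mA; pose gam := @normal_prob R 0 1.
have ms : measurable_fun setT (fun p : R * R => s * p.1 + e * p.2).
  by apply: measurable_funD; apply: measurable_funM.
pose S := [set p : R * R | A (s * p.1 + e * p.2)%R].
have mS : measurable S by rewrite -[S]setTI; exact: ms.
have mR : measurable_fun setT (fun t : R => (\1_A t)%:E : \bar R).
  exact/measurable_EFinP/measurable_indic.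
have R0 t : (0 <= (\1_A t)%:E :> \bar R)%E by rewrite lee_fin.
transitivity (\int[gam]_x \int[gam]_z (\1_A (s * x + e * z)%R)%:E)%E.
  transitivity (\int[gam \x gam]_p (\1_S p)%:E)%E.
    by rewrite integral_indic; [rewrite setIT|exact: measurableT|exact: mS].
  rewrite fubini_tonelli1//.
  exact/measurable_EFinP/measurable_indic.
transitivity (\int[gam]_t (\1_A (Num.sqrt (s ^+ 2 + e ^+ 2) * t + 0)%R)%:E)%E; last first.
  transitivity (\int[gam]_t
      (\1_((fun t => Num.sqrt (s ^+ 2 + e ^+ 2) * t)%R @^-1` A) t)%:E)%E.
    by apply: eq_integral => t _; rewrite addr0 !indicE.
  rewrite integral_indic// ?setIT//.
  by rewrite -[X in measurable X]setTI; apply: measurable_funM.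
(* Without the second summand the claim is the symmetry of the Gaussian, as
   [Num.sqrt (s ^+ 2)] is the absolute value of [s]. *)
have [->|e0] := eqVneq e 0.
  transitivity (\int[gam]_x (\1_A (s * x + 0))%:E)%E.
    apply: eq_integral => x _.
    rewrite (eq_integral (fun=> (\1_A (s * x + 0)%R)%:E)); last first.
      by move=> z _; rewrite mul0r.
    rewrite integral_cst// -[RHS]mule1; congr (_ * _)%E; exact: probability_setT.
  rewrite expr0n addr0 sqrtr_sqr; have [->|s0] := eqVneq s 0; first by rewrite normr0.
  have ns0 : `|s| != 0 by rewrite normr_eq0.
  rewrite (ge0_integral_std_normal_affine 0 s0 mR R0).
  by rewrite (ge0_integral_std_normal_affine 0 ns0 mR R0) normr_id.
have sg0 : Num.sqrt (s ^+ 2 + e ^+ 2) != 0.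
  rewrite gt_eqF// sqrtr_gt0 ltr_wpDl ?sqr_ge0//.
  by rewrite lt_neqAle eq_sym sqrf_eq0 e0 sqr_ge0.
rewrite (ge0_integral_std_normal_affine 0 sg0 mR R0).
rewrite [`|Num.sqrt _|]ger0_norm; last exact: sqrtr_ge0.
set sg := Num.sqrt _ in sg0 *.
pose H (p : R * R) := ((\1_A p.2)%:E *
  (normal_pdf (s * p.1) `|e| p.2 * normal_pdf 0 1 p.1)%:E)%E.
have mH : measurable_fun setT H.
  apply: emeasurable_funM; first exact: measurableT_comp mR measurable_snd.
  apply/measurable_EFinP; apply: measurable_funM; last first.
    apply: measurableT_comp measurable_fst; exact: measurable_normal_pdf.
  rewrite (_ : (fun _ => _) = (fun p : R * R =>
    normal_peak `|e| * expR (- (p.2 - s * p.1) ^+ 2 / (`|e| ^+ 2 *+ 2)))); last first.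
    by apply/funext => p; rewrite normal_pdfE ?normr_eq0.
  apply: measurable_funM => //; apply: measurableT_comp => //.
  apply: measurable_funM => //; apply: measurableT_comp => //.
  apply: measurable_funX; apply: measurable_funB => //.
  by apply: measurable_funM.
have H0 p : (0 <= H p)%E.
  by rewrite /H mule_ge0 ?lee_fin// mulr_ge0 ?normal_pdf_ge0.
transitivity (\int[lebesgue_measure]_x \int[lebesgue_measure]_t H (x, t))%E.
  rewrite [LHS]ge0_integral_normal_prob; last 2 first.
  - apply: (@measurable_fun_fubini_tonelli_F _ _ _ _ _ gam (EFin \o \1_S)) => //.
      exact/measurable_EFinP/measurable_indic.
    by move=> p; rewrite lee_fin.
  - by move=> x; apply: integral_ge0.
  apply: eq_integral => x _.
  under eq_integral => z _ do rewrite addrC.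
  rewrite (ge0_integral_std_normal_affine (s * x) e0 mR R0).
  rewrite (ge0_integral_normal_prob _ _ mR R0).
  rewrite -ge0_integralZr; [| exact: measurableT | | |].
  - by apply: eq_integral => t _; rewrite -muleA -EFinM.
  - apply: emeasurable_funM; [exact: mR|apply/measurable_EFinP; exact: measurable_normal_pdf].
  - by move=> t _; rewrite mule_ge0 ?lee_fin// normal_pdf_ge0.
  - by rewrite lee_fin normal_pdf_ge0.
etransitivity; first exact: (@fubini_tonelli _ _ _ _ _ lebesgue_measure lebesgue_measure H mH H0).
rewrite [RHS](ge0_integral_normal_prob _ _ mR R0).
apply: eq_integral => t _.
transitivity (\int[lebesgue_measure]_x (((\1_A t)%:E * (normal_pdf 0 sg t)%:E) *
   (normal_pdf (s * t / sg ^+ 2) (`|e| / sg) x)%:E))%E.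
  apply: eq_integral => x _; rewrite /H /= (normal_pdf_conv s x t e0).
  by rewrite EFinM muleA.
rewrite ge0_integralZl; [|exact: measurableT| | |].
- by rewrite integral_normal_pdf mule1.
- by apply/measurable_EFinP; exact: measurable_normal_pdf.
- by move=> x _; rewrite lee_fin normal_pdf_ge0.
- by rewrite mule_ge0 ?lee_fin ?normal_pdf_ge0.
Qed.

(** * One-dimensional marginals of the standard Gaussian *)

(** Rectangles are stable under intersection.  Neither measure has to be a
    product, so scaled measures and restrictions to events are covered. *)
Lemma eq_measure_rectangles d1 d2 (T1 : measurableType d1)
    (T2 : measurableType d2) (R : realType)
    (m m' : {measure set (T1 * T2) -> \bar R}) :
  (m setT < +oo)%E ->
  (forall A B, measurable A -> measurable B -> m (A `*` B) = m' (A `*` B)) ->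
  forall X, measurable X -> m X = m' X.
Proof.
move=> moo mm' X mX.
pose C : set (set (T1 * T2)) :=
  [set C | exists A, measurable A /\ exists B, measurable B /\ C = A `*` B].
apply: (measure_unique C (fun=> setT)) => //.
- rewrite measurable_prod_measurableType //; congr (<<s _ >>).
  rewrite predeqE; split => [[A mA [B mB <-]]|[A [mA [B [mB ->]]]]].
    by exists A; split => //; exists B.
  by exists A => //; exists B.
- move=> /= _ _ [X1 [mX1 [X2 [mX2 ->]]]] [Y1 [mY1 [Y2 [mY2 ->]]]].
  rewrite -setXI; exists (X1 `&` Y1); split; first exact: measurableI.
  by exists (X2 `&` Y2); split => //; exact: measurableI.
- by move=> _; exists setT; split => //; exists setT; split => //; rewrite setXTT.
- by rewrite bigcup_const//; exists 0%N.
- by move=> A [A1 [mA1 [A2 [mA2 ->]]]]; exact: mm'.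
Qed.

Lemma measurable_tnth_preimage (R : realType) (d : nat) (i : 'I_d) (B : set R) :
  measurable B -> measurable [set t : d.-tuple R | B (tnth t i)].
Proof.
by move=> mB; rewrite -[X in measurable X]setTI; exact: (measurable_tnth i).
Qed.

Lemma measurable_box (R : realType) (d : nat) (I : pred 'I_d) (B : 'I_d -> set R) :
  (forall i, measurable (B i)) ->
  measurable [set t : d.-tuple R | forall i, I i -> B i (tnth t i)].
Proof.
move=> mB.
apply: (@fin_bigcap_measurable _ _ _ [set i | I i]
  (fun i => [set t : d.-tuple R | B i (tnth t i)])) => [|i _].
  exact: finite_finset.
exact: measurable_tnth_preimage.
Qed.

Lemma measurable_lincomb (R : realType) (d : nat) (I : pred 'I_d) (e : 'I_d -> R) :
  measurable_fun setT (fun t : d.-tuple R => \sum_(i | I i) e i * tnth t i).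
Proof.
under eq_fun do rewrite big_mkcond; apply: measurable_sum => i.
case: (I i) => //; apply: measurable_funM => //; exact: measurable_tnth.
Qed.

(** Induction on the number [k] of summed coordinates.  The boxes [B] constrain
    the coordinates that are not summed yet: they carry the independence from
    the partial sum through the induction. *)
Lemma gaussian_partial_sums (R : realType) (d : nat) disp
    (T : measurableType disp) (P : probability T R) (Z : {RV P >-> d.-tuple R})
    (e : 'I_d -> R) (k : nat) :
  std_gaussian Z -> (k <= d)%N ->
  forall (A : set R) (B : 'I_d -> set R),
  measurable A -> (forall i, measurable (B i)) ->
  distribution P Z [set t | A (\sum_(i < d | (i < k)%N) e i * tnth t i) /\
    forall i : 'I_d, (k <= i)%N -> B i (tnth t i)] =
  (normal_prob 0 1
     ((fun x => Num.sqrt (\sum_(i < d | (i < k)%N) e i ^+ 2) * x)%R @^-1` A) *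
   \prod_(i < d | (k <= i)%N) normal_prob 0 1 (B i))%E.
Proof.
move=> gZ; elim: k => [_|k IH kd] A B mA mB.
  rewrite big_pred0// sqrtr0.
  under eq_bigl do rewrite leq0n.
  have [A0|nA0] := pselect (A 0).
    rewrite (_ : _ @^-1` A = setT); last first.
      by apply/seteqP; split => // x _ /=; rewrite mul0r.
    rewrite [X in (X * _)%E]probability_setT mul1e -gZ//; congr (distribution P Z _).
    apply/seteqP; split => [t /= [_ h] i|t /= h]; first exact: h.
    by split => //; rewrite big_pred0.
  rewrite (_ : _ @^-1` A = set0); last first.
    by apply/seteqP; split => // x /=; rewrite mul0r.
  rewrite measure0 mul0e (_ : [set _ | _] = set0) ?measure0//.
  by apply/seteqP; split => // t /= []; rewrite big_pred0.
pose i0 := Ordinal kd.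
pose gam : probability (measurableTypeR R) R := normal_prob 0 1.
have splitk (F : 'I_d -> R) : \sum_(i < d | (i < k.+1)%N) F i =
    \sum_(i < d | (i < k)%N) F i + F i0.
  rewrite (bigD1 i0)//= addrC; congr (_ + _); apply: eq_bigl => i.
  by rewrite ltnS -val_eqE /= [RHS]ltn_neqAle andbC.
have splitp (F : 'I_d -> \bar R) : (\prod_(i < d | (k <= i)%N) F i =
    F i0 * \prod_(i < d | (k.+1 <= i)%N) F i)%E.
  rewrite (bigD1 i0)//=; congr (_ * _)%E; apply: eq_bigl => i.
  by rewrite -val_eqE /= [RHS]ltn_neqAle andbC eq_sym.
set sg := Num.sqrt (\sum_(i < d | (i < k)%N) e i ^+ 2).
set c := (\prod_(i < d | (k.+1 <= i)%N) normal_prob 0 1 (B i))%E.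
have c0 : (0 <= c)%E by apply: prode_ge0 => i _; exact: measure_ge0.
have cfin : c \is a fin_num.
  rewrite /c; elim/big_ind: _ => //; first exact: fin_numM.
  by move=> i _; exact: (fin_num_measure gam _ (mB i)).
pose r : {nonneg R} := NngNum (fine_ge0 c0).
have rE : (r%:num)%:E = c by rewrite /= fineK.
pose E := [set t : d.-tuple R | forall i : 'I_d, (k.+1 <= i)%N -> B i (tnth t i)].
have mE : measurable E by exact: measurable_box.
pose S (t : d.-tuple R) := \sum_(i < d | (i < k)%N) e i * tnth t i.
have mS : measurable_fun setT S by exact: measurable_lincomb.
have mg : measurable_fun setT (fun t : d.-tuple R => (S t, tnth t i0)).
  by apply/measurable_fun_pair => //; exact: measurable_tnth.
have mf : measurable_fun setT (fun p : R * R => (sg * p.1, p.2)).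
  by apply/measurable_fun_pair => //; exact: measurable_funM.
pose nu : {measure set (R * R) -> \bar R} :=
  image_measure (mrestr (distribution P Z) mE) mg.
pose m : {measure set (R * R) -> \bar R} :=
  mscale r (image_measure (gam \x gam)%E mf).
(* [nu] is the joint law of the partial sum and of coordinate [k], restricted to
   the event that the later coordinates are in their boxes. *)
have key X : measurable X -> nu X = m X.
  apply: eq_measure_rectangles => [|C D mC mD].
    rewrite /nu /= /pushforward /mrestr.
    apply: (@le_lt_trans _ _ 1%E); last exact: ltry.
    by rewrite preimage_setT setTI; exact: probability_le1.
  rewrite /nu /m /= /mscale /= /pushforward /mrestr.
  rewrite (_ : (fun p : R * R => (sg * p.1, p.2)) @^-1` (C `*` D) =
    ((fun x => sg * x) @^-1` C) `*` D)//.
  rewrite (product_measure1E gam gam)//; last first.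
    by rewrite -[X in measurable X]setTI; apply: measurable_funM.
  pose B' i := if i == i0 then D else B i.
  rewrite (_ : _ `&` E = [set t | C (S t) /\
      forall i : 'I_d, (k <= i)%N -> B' i (tnth t i)]); last first.
    apply/seteqP; split => t /=.
      move=> [[Ct Dt] Et]; split => // i ki; rewrite /B'.
      have [->//|ii0] := eqVneq i i0.
      by apply: Et; rewrite ltn_neqAle ki andbT eq_sym -[_ == _]/(i == i0).
    move=> [Ct h]; split; first by split=> //; have := h i0 (leqnn _); rewrite /B' eqxx.
    move=> i ki; have := h i (ltnW ki); rewrite /B'.
    by rewrite (_ : i == i0 = false)//; apply/negbTE; rewrite -val_eqE /= gtn_eqF.
  rewrite IH//; [|exact: ltnW|by move=> i; rewrite /B'; case: ifP].
  rewrite splitp /B' eqxx rE muleA [RHS]muleC; congr (_ * _)%E.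
  apply: eq_bigr => i ki.
  by rewrite (_ : i == i0 = false)//; apply/negbTE; rewrite -val_eqE /= gtn_eqF.
have mA' : measurable [set p : R * R | A (p.1 + e i0 * p.2)].
  have ms : measurable_fun setT (fun p : R * R => p.1 + e i0 * p.2).
    by apply: measurable_funD => //; apply: measurable_funM.
  by rewrite -[X in measurable X]setTI; exact: ms.
transitivity (nu [set p : R * R | A (p.1 + e i0 * p.2)]).
  rewrite /nu /= /pushforward /mrestr; congr (distribution P Z _).
  by apply/seteqP; split => t /=; rewrite splitk.
rewrite (key _ mA') /m /= /mscale /= /pushforward -/c -rE muleC; congr (_ * _)%E.
rewrite (_ : _ @^-1` _ = [set p : R * R | A (sg * p.1 + e i0 * p.2)])//.
rewrite (normal_prob_conv sg (e i0) mA) splitk /sg sqr_sqrtr// sumr_ge0// => i _.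
exact: sqr_ge0.
Qed.

Lemma gaussian_projection (R : realType) (d : nat) disp
    (T : measurableType disp) (P : probability T R) (Z : {RV P >-> d.-tuple R})
    (e : 'I_d -> R) (A : set R) :
  std_gaussian Z -> \sum_i e i ^+ 2 = 1 -> measurable A ->
  distribution P Z [set t | A (\sum_i e i * tnth t i)] = normal_prob 0 1 A.
Proof.
move=> gZ e1 mA.
have := gaussian_partial_sums e gZ (leqnn d) mA (fun=> measurableT).
have lt_d (F : 'I_d -> R) : \sum_(i < d | (i < d)%N) F i = \sum_i F i.
  by apply: eq_bigl => i; rewrite ltn_ord.
rewrite [X in (_ * X)%E]big_pred0; last by move=> i; rewrite leqNgt ltn_ord.
rewrite mule1 lt_d e1 sqrtr1.
rewrite (_ : _ @^-1` A = A); last by apply/seteqP; split => x /=; rewrite mul1r.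
move=> <-; congr (distribution P Z _).
by apply/seteqP; split => t /=; rewrite lt_d // => -[].
Qed.

(** * Euclidean norm *)

Lemma dotpE (R : realType) (d : nat) (x y : 'cV[R]_d) :
  dotp x y = \sum_i x i 0 * y i 0.
Proof. by rewrite /dotp mxE; apply: eq_bigr => i _; rewrite mxE. Qed.

Lemma dotpC (R : realType) (d : nat) (x y : 'cV[R]_d) : dotp x y = dotp y x.
Proof. by rewrite !dotpE; apply: eq_bigr => i _; rewrite mulrC. Qed.

Lemma dotpDl (R : realType) (d : nat) (x y z : 'cV[R]_d) :
  dotp (x + y) z = dotp x z + dotp y z.
Proof. by rewrite /dotp linearD /= mulmxDl mxE. Qed.

Lemma dotpZl (R : realType) (d : nat) (k : R) (x z : 'cV[R]_d) :
  dotp (k *: x) z = k * dotp x z.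
Proof. by rewrite /dotp linearZ /= -scalemxAl mxE. Qed.

Lemma dotpDr (R : realType) (d : nat) (x y z : 'cV[R]_d) :
  dotp z (x + y) = dotp z x + dotp z y.
Proof. by rewrite dotpC dotpDl !(dotpC z). Qed.

Lemma dotpZr (R : realType) (d : nat) (k : R) (x z : 'cV[R]_d) :
  dotp z (k *: x) = k * dotp z x.
Proof. by rewrite dotpC dotpZl (dotpC z). Qed.

Lemma dotp_ge0 (R : realType) (d : nat) (x : 'cV[R]_d) : 0 <= dotp x x.
Proof. by rewrite dotpE sumr_ge0// => i _; rewrite -expr2 sqr_ge0. Qed.

Lemma enorm_ge0 (R : realType) (d : nat) (x : 'cV[R]_d) : 0 <= enorm x.
Proof. exact: sqrtr_ge0. Qed.

Lemma enorm_sqr (R : realType) (d : nat) (x : 'cV[R]_d) : enorm x ^+ 2 = dotp x x.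
Proof. by rewrite sqr_sqrtr ?dotp_ge0. Qed.

Lemma enorm_eq0 (R : realType) (d : nat) (x : 'cV[R]_d) : (enorm x == 0) = (x == 0).
Proof.
rewrite -sqrf_eq0 enorm_sqr dotpE psumr_eq0; last first.
  by move=> i _; rewrite -expr2 sqr_ge0.
apply/allP/eqP => [h|-> i _]; last by rewrite mxE mul0r eqxx.
apply/matrixP => i j; rewrite ord1 mxE; apply/eqP.
by have := h i (mem_index_enum i); rewrite /= -expr2 sqrf_eq0.
Qed.

Lemma enorm0 (R : realType) (d : nat) : enorm (0 : 'cV[R]_d) = 0.
Proof. by apply/eqP; rewrite enorm_eq0. Qed.

Lemma enormZ (R : realType) (d : nat) (k : R) (x : 'cV[R]_d) :
  enorm (k *: x) = `|k| * enorm x.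
Proof.
by rewrite /enorm dotpZl dotpZr mulrA -expr2 sqrtrM ?sqr_ge0// sqrtr_sqr.
Qed.

(** * The coupling reduces to one Gaussian and one uniform variable *)

Lemma enorm_unit_dir (R : realType) (d : nat) (u v : 'cV[R]_d) :
  u != v -> enorm (unit_dir u v) = 1.
Proof.
move=> uv; rewrite /unit_dir uv enormZ ger0_norm ?invr_ge0 ?enorm_ge0//.
by rewrite mulVf// enorm_eq0 subr_eq0.
Qed.

Lemma unit_dirE (R : realType) (d : nat) (u v : 'cV[R]_d) :
  u - v = enorm (u - v) *: unit_dir u v.
Proof.
rewrite /unit_dir; case: eqVneq => [->|uv /=]; first by rewrite subrr enorm0 scale0r.
by rewrite scalerA mulfV ?scale1r// enorm_eq0 subr_eq0.
Qed.

Lemma householderE (R : realType) (d : nat) (e z : 'cV[R]_d) :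
  (1%:M - 2 *: (e *m e^T)) *m z = z - (2 * dotp e z) *: e.
Proof.
rewrite mulmxBl mul1mx -scalemxAl -mulmxA [e^T *m z]mx11_scalar.
by rewrite mul_mx_scalar scalerA.
Qed.

(** Expanding the squares, the contribution of [z] orthogonal to [p - q]
    cancels.  When [p = q] both sides are 1, the unit direction being 0. *)
Lemma gauss_pdf_ratio (R : realType) (d : nat) (h : R) (p q z : 'cV[R]_d) :
  0 < h ->
  gauss_pdf q h (p + Num.sqrt h *: z) / gauss_pdf p h (p + Num.sqrt h *: z) =
  expR (- (enorm (p - q) *
    (enorm (p - q) + 2 * Num.sqrt h * dotp (unit_dir p q) z)) / (2 * h)).
Proof.
move=> h0.
have C0 : 0 < (2 * pi * h) `^ (d%:R / 2) by rewrite powR_gt0// !mulr_gt0 ?pi_gt0.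
rewrite /gauss_pdf -mulf_div divff ?mul1r; last by rewrite invr_neq0// gt_eqF.
rewrite -expRN -expRD; congr expR.
have -> : p + Num.sqrt h *: z - q =
    enorm (p - q) *: unit_dir p q + Num.sqrt h *: z.
  by rewrite -unit_dirE addrAC.
rewrite [p + _ - p]addrC addKr !enorm_sqr !(dotpDl, dotpDr, dotpZl, dotpZr).
rewrite (dotpC z) -enorm_sqr.
have : enorm (p - q) = 0 \/ enorm (unit_dir p q) = 1.
  have [->|pq] := eqVneq p q; first by left; rewrite subrr enorm0.
  by right; rewrite enorm_unit_dir.
by case=> ->; field; rewrite gt_eqF.
Qed.

(** On rejection, the two noises differ by twice the component along [e], so
    the difference of the chains stays on the line spanned by [e]. *)
Lemma coupling_distance (R : realType) (d : nat) (h : R) (b : 'cV[R]_d -> 'cV[R]_d)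
    (x y z : 'cV[R]_d) (u : R) : 0 < h ->
  let e := unit_dir (euler h b x) (euler h b y) in
  let r := enorm (euler h b x - euler h b y) in
  let t := r + 2 * Num.sqrt h * dotp e z in
  enorm (couplingX h b x z - couplingY h b x y z u) =
  if u <= expR (- (r * t) / (2 * h)) then 0 else `|t|.
Proof.
move=> h0 e r t; rewrite /couplingY /couplingX gauss_pdf_ratio// -/r -/e -/t.
case: ifP => _; first by rewrite subrr enorm0.
rewrite householderE -/e.
have -> : euler h b x + Num.sqrt h *: z -
    (euler h b y + Num.sqrt h *: (z - (2 * dotp e z) *: e)) = t *: e.
  rewrite /t scalerDl -[in RHS]unit_dirE scalerBr scalerA opprD opprB.
  rewrite addrACA; congr (_ + _); rewrite addrC subrK.
  by rewrite mulrCA mulrA.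
rewrite enormZ; have [xy|xy] := eqVneq (euler h b x) (euler h b y).
  rewrite /t /r /e /unit_dir xy eqxx /= subrr enorm0 mulr0.
  by rewrite /dotp trmx0 mul0mx mxE mulr0 addr0 normr0.
by rewrite enorm_unit_dir ?mulr1.
Qed.

Lemma uniform_prob_gt (R : realType) (c : R) : 0 <= c ->
  (uniform_prob (@ltr01 R) `]c, +oo[ = (Num.max 0 (1 - c))%:E)%E.
Proof.
move=> c0.
have mI : measurable_fun setT (fun x : R => (\1_`]c, +oo[ x)%:E : \bar R).
  exact/measurable_EFinP/measurable_indic.
transitivity (\int[uniform_prob (@ltr01 R)]_x (\1_`]c, +oo[ x)%:E)%E.
  by rewrite integral_indic// setIT.
rewrite integral_uniform//.
rewrite subr0 invr1 mul1e integral_indic//.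
transitivity (lebesgue_measure (`]c, 1]%classic : set R)); last first.
  rewrite lebesgue_measure_itv/= lte_fin; case: ltP => c1.
    by rewrite -EFinB max_r// subr_ge0 ltW.
  by rewrite max_l// subr_le0.
congr lebesgue_measure; apply/seteqP; split => x /=; rewrite !in_itv/= ?andbT.
  by move=> [cx /andP[_ x1]]; rewrite cx.
by case/andP => cx x1; split => //; rewrite x1 (le_trans c0 (ltW cx)).
Qed.

(** The pair formed by the component of the noise along [e] and the uniform
    variable is independent, with standard normal and uniform marginals. *)
Lemma ge0_integral_coupling_law (R : realType) (d : nat) disp
    (T : measurableType disp) (P : probability T R)
    (Z : {RV P >-> d.-tuple R}) (U : {RV P >-> R}) (e : 'cV[R]_d)
    (H : R * R -> \bar R) :
  std_gaussian Z -> uniform01 U -> independent_RVs Z U -> enorm e = 1 ->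
  measurable_fun setT H -> (forall p, 0 <= H p)%E ->
  (\int[P]_w H (dotp e (cvec (Z w)), U w) =
   \int[normal_prob 0 1]_v \int[uniform_prob (@ltr01 R)]_u H (v, u))%E.
Proof.
move=> gZ uU iZU e1 mH H0.
pose gam : probability (measurableTypeR R) R := normal_prob 0 1.
pose unif : probability (measurableTypeR R) R := uniform_prob (@ltr01 R).
pose S (t : d.-tuple R) := \sum_i e i 0 * tnth t i.
have mS : measurable_fun setT S by exact: measurable_lincomb.
have SE w : dotp e (cvec (Z w)) = S (Z w).
  by rewrite dotpE; apply: eq_bigr => i _; rewrite mxE.
have mg : measurable_fun setT (fun w => (S (Z w), U w)).
  by apply: measurable_fun_pair => //; apply: measurableT_comp.
pose nu : {measure set (measurableTypeR R * measurableTypeR R) -> \bar R} :=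
  @image_measure _ _ T (measurableTypeR R * measurableTypeR R)%type R P _ mg.
transitivity (\int[nu]_p H p)%E.
  rewrite ge0_integral_pushforward//.
  by apply: eq_integral => w _; rewrite /= SE.
transitivity (\int[gam \x unif]_p H p)%E; last by rewrite fubini_tonelli1.
apply: eq_measure_integral; move=> X mX _.
apply/esym; refine (@product_measure_unique _ _ _ _ _ gam unif nu _ X mX).
move=> A B mA mB.
have mSA : measurable (S @^-1` A) by rewrite -[X in measurable X]setTI; exact: mS.
have es : \sum_i e i 0 ^+ 2 = 1.
  by rewrite -[RHS](expr1n _ 2) -e1 enorm_sqr dotpE; apply: eq_bigr => i _; rewrite expr2.
rewrite /= /pushforward.
transitivity (P (Z @^-1` (S @^-1` A) `&` U @^-1` B)); first by [].
rewrite iZU//; congr (_ * _)%E; last exact: uU.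
exact: (gaussian_projection (e := fun i => e i 0) gZ es mA).
Qed.

Lemma expectation_coupling (R : realType) (d : nat) (h : R)
    (b : 'cV[R]_d -> 'cV[R]_d) disp
    (T : measurableType disp) (P : probability T R)
    (Z : {RV P >-> d.-tuple R}) (U : {RV P >-> R}) (x y : 'cV[R]_d) (F : R -> R) :
  0 < h -> std_gaussian Z -> uniform01 U -> independent_RVs Z U ->
  euler h b x != euler h b y ->
  F 0 = 0 -> (forall t, 0 <= F t) -> measurable_fun setT F ->
  let r := enorm (euler h b x - euler h b y) in
  let t v := r + 2 * Num.sqrt h * v in
  ('E_P[fun w : T => F (enorm (couplingX h b x (cvec (Z w)) -
          couplingY h b x y (cvec (Z w)) (U w)))] =
   \int[lebesgue_measure]_v (F `|t v| *
      Num.max 0 (1 - expR (- (r * t v) / (2 * h))) * normal_pdf 0 1 v)%:E)%E.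
Proof.
move=> h0 gZ uU iZU xy F0 Fge0 mF r t.
have mt : measurable_fun setT t.
  by apply: measurable_funD => //; apply: measurable_funM.
pose c v := expR (- (r * t v) / (2 * h)).
have mc : measurable_fun setT c.
  apply: measurableT_comp => //; apply: measurable_funM => //.
  by apply: measurableT_comp => //; apply: measurable_funM.
have mFt : measurable_fun setT (fun v => F `|t v|).
  by apply: measurableT_comp => //; exact: measurableT_comp.
pose H (p : R * R) : \bar R := (F `|t p.1| * \1_[set p : R * R | c p.1 < p.2] p)%:E.
have mE : measurable [set p : R * R | c p.1 < p.2].
  rewrite (_ : [set p | _] = (fun p : R * R => p.2 - c p.1) @^-1` `]0, +oo[).
    have md : measurable_fun setT (fun p : R * R => p.2 - c p.1).
      by apply: measurable_funB => //; exact: measurableT_comp.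
    by rewrite -[X in measurable X]setTI; exact: md.
  by apply/seteqP; split => p /=; rewrite in_itv/= andbT subr_gt0.
have mH : measurable_fun setT H.
  apply/measurable_EFinP; apply: measurable_funM; last exact: measurable_indic.
  exact: (measurableT_comp mFt).
have H0 p : (0 <= H p)%E by rewrite lee_fin mulr_ge0.
rewrite unlock.
transitivity (\int[P]_w H (dotp (unit_dir (euler h b x) (euler h b y)) (cvec (Z w)), U w))%E.
  apply: eq_integral => w _; rewrite /= coupling_distance// /H /=.
  rewrite -/r -/(t _) -/(c _) indicE.
  case: leP => cu.
    by rewrite memNset ?mulr0 ?F0//= ltNge cu.
  by rewrite mem_set ?mulr1.
rewrite (ge0_integral_coupling_law gZ uU iZU (enorm_unit_dir xy) mH H0).
transitivity (\int[normal_prob 0 1]_v (F `|t v| * Num.max 0 (1 - c v))%:E)%E.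
  apply: eq_integral => v _; rewrite /H /=.
  rewrite EFinM -uniform_prob_gt ?expR_ge0//.
  transitivity (\int[uniform_prob (@ltr01 R)]_u ((F `|t v|)%:E * (\1_(`]c v, +oo[%classic : set R) u)%:E))%E.
    apply: eq_integral => u _; rewrite -EFinM; congr (_ * _)%:E.
    by rewrite !indicE; congr (nat_of_bool _)%:R; apply/idP/idP;
      rewrite !inE /= in_itv /= andbT.
  rewrite ge0_integralZl//; first by rewrite integral_indic// setIT.
    by apply/measurable_EFinP; exact: measurable_indic.
  by rewrite lee_fin.
rewrite ge0_integral_normal_prob.
- by apply: eq_integral => v _; rewrite -EFinM.
- apply/measurable_EFinP; apply: measurable_funM => //.
  by apply: measurable_maxr => //; exact: measurable_funB.
- by move=> v; rewrite lee_fin mulr_ge0// le_max lexx.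
Qed.

(** * Elementary integrals *)

Lemma Rintegral_deriv_poly (R : realType) (p : {poly R}) (a b : R) : a <= b ->
  \int[lebesgue_measure]_(x in `[a, b]) (p^`()).[x] = p.[b] - p.[a].
Proof.
rewrite le_eqVlt => /predU1P[<-|ab]; first by rewrite set_itv1 Rintegral_set1 subrr.
rewrite /Rintegral (@continuous_FTC2 _ _ (horner p) a b ab)//.
- by apply: continuous_subspaceT; exact: continuous_horner.
- have cF x : {for x, continuous (horner p)} by exact: continuous_horner.
  split; [by []|apply: cvg_at_right_filter; exact: cF|].
  by apply: cvg_at_left_filter; exact: cF.
- by move=> x _; rewrite derive1E; apply: derive_val.
Qed.

Lemma Rintegral_quadratic (R : realType) (q0 q1 q2 u : R) : 0 <= u ->
  \int[lebesgue_measure]_(s in `[0, u]) (q0 + q1 * s + q2 * s ^+ 2) =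
  q0 * u + q1 * u ^+ 2 / 2 + q2 * u ^+ 3 / 3.
Proof.
move=> u0; pose p : {poly R} := q0 *: 'X + (q1 / 2) *: 'X^2 + (q2 / 3) *: 'X^3.
transitivity (\int[lebesgue_measure]_(s in `[0, u]) (p^`()).[s]).
  apply: eq_Rintegral => s _.
  rewrite /p !derivD !derivZ derivX !derivXn !hornerE /=.
  by field.
rewrite Rintegral_deriv_poly// /p !hornerE /=.
by field.
Qed.

(** * Closed forms for the metric *)

(** The quotient is [(a + r) / (c0 R * h)] for [Num.sqrt h <= r], and smaller
    values of [r] contribute no more, so the supremum is approached at the right
    end [s + Num.sqrt h] of the interval, which is excluded. *)
Lemma sup_ratioE (R : realType) (h a s : R) :
  0 < h -> 0 < c0 R -> a = 0 \/ Num.sqrt h <= a -> 0 < s ->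
  sup_ratio h a s = (a + Num.sqrt h + s) / (c0 R * h).
Proof.
move=> h0 c0_gt0 ah s0; set q := Num.sqrt h in ah *.
have q0 : 0 < q by rewrite sqrtr_gt0.
have hE : h = q * q by rewrite -expr2 sqr_sqrtr// ltW.
have c0n : c0 R != 0 by rewrite gt_eqF.
have qn : q != 0 by rewrite gt_eqF.
have ch0 : 0 < c0 R * h by rewrite mulr_gt0.
set M := (a + q + s) / (c0 R * h).
have ratio_large r : q <= r -> (a + Phi r) / alpha_low h r = (a + r) / (c0 R * h).
  by move=> qr; rewrite /alpha_low -/q min_r// /Phi hE mulrA.
have ub : ubound [set (a + Phi r) / alpha_low h r | r in Ihat h a s] M.
  move=> _ /= [r Ir <-].
  have [qr|rq] := leP q r.
    rewrite ratio_large// ler_pM2r ?invr_gt0// -addrA lerD2l.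
    move: Ir; rewrite /Ihat -/q; case: eqP => _ /=; last first.
      by rewrite in_itv/= addrC => /andP[_ /ltW].
    rewrite /I0 -/q (ltNge r) qr /= => -[_]; rewrite in_itv/= ltrBlDr addrC.
    by case/andP => /ltW.
  move: Ir; rewrite /Ihat -/q; case: eqP => [a0 /=|_]; last first.
    by rewrite /= in_itv/= gt_max => /andP[/andP[_ qr] _]; move: (lt_trans qr rq); rewrite ltxx.
  move=> [r0 _]; rewrite /M a0 !add0r /alpha_low -/q (min_l (ltW rq)) /Phi.
  rewrite ler_pdivlMr// hE.
  have -> : r / (c0 R * r * q) * (c0 R * (q * q)) = q.
    by field; rewrite c0n qn gt_eqF.
  by rewrite lerDl ltW.
have mem r : Num.max s q < r -> r < s + q -> Ihat h a s r.
  rewrite gt_max => /andP[sr qr] rs; rewrite /Ihat -/q; case: eqP => _ /=; last first.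
    by rewrite in_itv/= gt_max sr qr rs.
  split; first exact: lt_trans qr.
  rewrite /I0 -/q (ltNge r) (ltW qr)/= in_itv/= sr andbT ltrBlDr.
  by rewrite rs.
have msq : Num.max s q < s + q by rewrite gt_max ltrDl ltrDr s0 q0.
have ne : [set (a + Phi r) / alpha_low h r | r in Ihat h a s] !=set0.
  have [m1 m2] := midf_lt msq.
  by exists ((a + Phi ((Num.max s q + (s + q)) / 2)) /
    alpha_low h ((Num.max s q + (s + q)) / 2)), ((Num.max s q + (s + q)) / 2) => //; exact: mem.
apply/eqP; rewrite eq_le; apply/andP; split; first exact: ge_sup.
rewrite leNgt; apply/negP => supM.
set S := sup_ratio h a s in supM.
(* If the supremum [S] were smaller, the ratio would equal [S] at [r0], and any
   point between [r0] and the right end of the interval would exceed it. *)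
pose r0 := S * (c0 R * h) - a.
have r0s : r0 < s + q.
  by move: supM; rewrite /M ltr_pdivlMr// /r0; lra.
have m3 : Num.max r0 (Num.max s q) < s + q by rewrite gt_max r0s msq.
pose r := (Num.max r0 (Num.max s q) + (s + q)) / 2.
have [rl ru] := midf_lt m3; rewrite -/r in rl ru.
move: rl; rewrite gt_max => /andP[r0r mr].
have : (a + Phi r) / alpha_low h r <= S.
  by apply: ub_le_sup; [exists M|exists r => //; exact: mem].
rewrite ratio_large; last by move: mr; rewrite gt_max => /andP[_ /ltW].
by rewrite ler_pdivrMr//; move: r0r; rewrite /r0; lra.
Qed.

(** The formula of [sup_ratioE] fails at [s = 0] only, a null set. *)
Lemma int_ratioE (R : realType) (h a u : R) :
  0 < h -> 0 < c0 R -> a = 0 \/ Num.sqrt h <= a -> 0 <= u ->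
  int_ratio h a u = (2 * (a + Num.sqrt h) * u + u ^+ 2) / (2 * (c0 R * h)).
Proof.
move=> h0 c0_gt0 ah u0; set A := a + Num.sqrt h; set C := c0 R * h.
have C0 : C != 0 by rewrite gt_eqF// mulr_gt0.
pose G (s : R) := A / C + C^-1 * s + 0 * s ^+ 2.
have GE s : 0 < s -> sup_ratio h a s = G s.
  by move=> s0; rewrite sup_ratioE// /G -/A -/C; field.
have cG : continuous G.
  move=> x; apply: cvgD; [apply: cvgD; [exact: cvg_cst|]|].
    by apply: cvgM; [exact: cvg_cst|exact: cvg_id].
  by apply: cvgM; [exact: cvg_cst|exact: exprn_continuous].
have iG : lebesgue_measure.-integrable `[0, u] (EFin \o G).
  by apply: continuous_compact_integrable; [exact: segment_compact|exact: continuous_subspaceT].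
have iGo : lebesgue_measure.-integrable `]0, u] (EFin \o G).
  by apply: integrableS iG => //; exact: subset_itv_oc_cc.
transitivity (\int[lebesgue_measure]_(s in `[0, u]) G s); last first.
  by rewrite Rintegral_quadratic//; field.
rewrite /int_ratio -Rintegral_itv_obnd_cbnd.
  rewrite -[RHS]Rintegral_itv_obnd_cbnd//.
  by apply: eq_Rintegral => s; rewrite inE/= in_itv/= => /andP[s0 _]; exact: GE.
apply: eq_integrable iGo => // s; rewrite inE/= in_itv/= => /andP[s0 _].
by rewrite GE.
Qed.

(** The truncated argument freezes the slope beyond [M], where the metric is
    affine. *)
Definition bent_slope (R : realType) (k A M s : R) : R :=
  1 - k * (2 * A * Num.min s M + Num.min s M ^+ 2).

Definition bent_profile (R : realType) (k A M r : R) : R :=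
  let m := Num.min r M in
  m - k * (A * m ^+ 2 + m ^+ 3 / 3) + bent_slope k A M r * (r - m).

(** The coefficient of [s ^+ 2] in [1 - g_fun]. *)
Definition bending (R : realType) (h M a : R) : R := c_const h M a / (c0 R * h).

Lemma g_funE (R : realType) (h M a s : R) :
  0 < h -> 0 < c0 R -> a = 0 \/ Num.sqrt h <= a -> 0 <= s <= M ->
  g_fun h M a s = bent_slope (bending h M a) (a + Num.sqrt h) M s.
Proof.
move=> h0 c0_gt0 ah /andP[s0 sM]; rewrite /g_fun int_ratioE// /bent_slope min_l// /bending.
by field; rewrite !gt_eqF.
Qed.

Lemma f_funE (R : realType) (h M a r : R) :
  0 < h -> 0 < c0 R -> a = 0 \/ Num.sqrt h <= a -> 0 <= M -> 0 <= r ->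
  f_fun h M a r = bent_profile (bending h M a) (a + Num.sqrt h) M r.
Proof.
move=> h0 c0_gt0 ah M0 r0; set k := bending _ _ _; set A := a + _.
pose G (m : R) := 1 + - (k * (2 * A)) * m + - k * m ^+ 2.
have cG : continuous G.
  move=> x; apply: cvgD; [apply: cvgD; [exact: cvg_cst|]|].
    by apply: cvgM; [exact: cvg_cst|exact: cvg_id].
  by apply: cvgM; [exact: cvg_cst|exact: exprn_continuous].
have slopeE s : bent_slope k A M s = G (Num.min s M) by rewrite /bent_slope /G; ring.
have intG u : 0 <= u -> \int[lebesgue_measure]_(s in `[0, u]) G s =
    u - k * (A * u ^+ 2 + u ^+ 3 / 3).
  by move=> u0; rewrite Rintegral_quadratic//; field.
have fE u : f_fun h M a u = \int[lebesgue_measure]_(s in `[0, u]) G (Num.min s M).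
  apply: eq_Rintegral => s; rewrite inE/= in_itv/= => /andP[s0 _].
  rewrite g_funE//; last by rewrite le_min s0 M0 ge_min lexx orbT.
  by rewrite slopeE [Num.min (Num.min s M) M]min_l// ge_min lexx orbT.
rewrite fE /bent_profile slopeE; have [rM|Mr] := leP r M.
  rewrite subrr mulr0 addr0 -intG//.
  apply: eq_Rintegral => s; rewrite inE/= in_itv/= => /andP[_ sr].
  by rewrite min_l// (le_trans sr).
have cGM : continuous (fun s : R => G (Num.min s M)).
  move=> x; apply: (continuous_comp (f := fun s => Num.min s M)); last exact: cG.
  by apply: continuous_min; [exact: cvg_id|exact: cvg_cst].
have iGM : lebesgue_measure.-integrable `[0, r] (EFin \o (fun s : R => G (Num.min s M))).
  by apply: continuous_compact_integrable; [exact: segment_compact|exact: continuous_subspaceT].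
have := Rintegral_itvB iGM (x := M).
rewrite !bnd_simp => /(_ M0 (ltW Mr)) /eqP; rewrite subr_eq => /eqP ->.
rewrite addrC; congr (_ + _).
  rewrite -intG//; apply: eq_Rintegral => s; rewrite inE/= in_itv/= => /andP[_ sM].
  by rewrite min_l.
transitivity (\int[lebesgue_measure]_(s in `]M, r]) G M).
  apply: eq_Rintegral => s; rewrite inE/= in_itv/= => /andP[Ms _].
  by rewrite min_r// ltW.
rewrite Rintegral_cst//; congr (_ * _).
transitivity (fine (lebesgue_measure (`]M, r]%classic : set R))); first by [].
by rewrite lebesgue_measure_itv/= lte_fin Mr -EFinB.
Qed.

(** * Concavity of the profile *)

Section BentProfile.
Variables (R : realType) (k A M : R).
Hypotheses (k0 : 0 <= k) (A0 : 0 <= A) (M0 : 0 < M).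
Hypothesis kM : k * (2 * A * M + M ^+ 2) <= 2^-1.
Local Notation p := (bent_profile k A M).
Local Notation g := (bent_slope k A M).

Lemma bent_profile_small r : r <= M -> p r = r - k * (A * r ^+ 2 + r ^+ 3 / 3).
Proof. by move=> rM; rewrite /bent_profile min_l// subrr mulr0 addr0. Qed.

Lemma bent_slope_small r : r <= M -> g r = 1 - k * (2 * A * r + r ^+ 2).
Proof. by move=> rM; rewrite /bent_slope min_l. Qed.

Lemma bent_slope_large r : M <= r -> g r = g M.
Proof. by move=> Mr; rewrite /bent_slope min_r// minxx. Qed.

Lemma bent_profile_large r : M <= r -> p r = p M + g M * (r - M).
Proof.
by move=> Mr; rewrite (bent_profile_small (lexx M)) /bent_profile min_r// bent_slope_large.
Qed.

Lemma bent_profile0 : p 0 = 0.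
Proof. by rewrite bent_profile_small ?ltW// !expr0n /=; ring. Qed.

Lemma bent_slope_bounds s : 0 <= s -> 2^-1 <= g s <= 1.
Proof.
have [A0' M0'] := (A0, M0); move=> s0.
have hs u : 0 <= u <= M -> 2^-1 <= g u <= 1.
  move=> /andP[u0 uM]; rewrite bent_slope_small//.
  have q0 : 0 <= k * (2 * A * u + u ^+ 2).
    by rewrite !(mulr_ge0, addr_ge0, sqr_ge0).
  have qM : k * (2 * A * u + u ^+ 2) <= k * (2 * A * M + M ^+ 2).
    apply: ler_wpM2l => //; apply: lerD; first by apply: ler_wpM2l => //; rewrite mulr_ge0.
    by rewrite ler_sqr// nnegrE ltW.
  by move: q0 (le_trans qM kM); set X := k * _ => ? ?; apply/andP; split; lra.
have [sM|Ms] := leP s M; first by apply: hs; rewrite s0.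
by rewrite (bent_slope_large (ltW Ms)) hs// lexx ltW.
Qed.

(** A cubic minus its tangent at [r] has a double zero at [r]. *)
Lemma tangent_defect_small r t : r <= M -> t <= M ->
  p r + g r * (t - r) - p t = k * (t - r) ^+ 2 * (A + (t + 2 * r) / 3).
Proof. by move=> rM tM; rewrite !bent_profile_small// bent_slope_small//; field. Qed.

Lemma tangent_defect_large r t : r <= M -> M <= t ->
  p r + g r * (t - r) - p t =
  k * (M - r) * ((M - r) * (A + (M + 2 * r) / 3) + (2 * A + M + r) * (t - M)).
Proof.
have [A0' M0'] := (A0, M0); move=> rM tM; rewrite (bent_profile_large tM) !bent_profile_small// !bent_slope_small//.
by field.
Qed.

Lemma bent_profile_tangent r t : 0 <= r -> 0 <= t -> p t <= p r + g r * (t - r).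
Proof.
have [A0' M0'] := (A0, M0).
have small u v : 0 <= u <= M -> 0 <= v -> p v <= p u + g u * (v - u).
  move=> /andP[u0 uM] v0; rewrite -subr_ge0.
  have [vM|Mv] := leP v M.
    have q0 : 0 <= A + (v + 2 * u) / 3 by lra.
    by rewrite tangent_defect_small// mulr_ge0// mulr_ge0// sqr_ge0.
  have Mu : 0 <= M - u by rewrite subr_ge0.
  have vM : 0 <= v - M by rewrite subr_ge0 ltW.
  have q1 : 0 <= A + (M + 2 * u) / 3 by lra.
  have q2 : 0 <= 2 * A + M + u by lra.
  rewrite (tangent_defect_large uM (ltW Mv)) mulr_ge0 ?(mulr_ge0 k0)//.
  by rewrite addr_ge0// mulr_ge0.
move=> r0 t0; have [rM|Mr] := leP r M; first by rewrite small// r0.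
rewrite (bent_slope_large (ltW Mr)) (bent_profile_large (ltW Mr)).
have := small M t; rewrite lexx ltW// => /(_ isT t0); lra.
Qed.

(** The two tangent inequalities, at [r] and at [t], with slopes in
    [[1/2, 1]]. *)
Lemma bent_profile_increment r t : 0 <= r -> r <= t ->
  (t - r) / 2 <= p t - p r <= t - r.
Proof.
have [A0' M0'] := (A0, M0); move=> r0 rt; have t0 := le_trans r0 rt.
have trs : 0 <= t - r by rewrite subr_ge0.
have := bent_profile_tangent r0 t0; have := bent_profile_tangent t0 r0.
have /andP[gr _] := bent_slope_bounds r0; have /andP[_ gr1] := bent_slope_bounds r0.
have /andP[gt gt1] := bent_slope_bounds t0.
move=> h1 h2.
have : 2^-1 * (t - r) <= g t * (t - r) by rewrite ler_wpM2r.
have : g r * (t - r) <= 1 * (t - r) by rewrite ler_wpM2r.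
have e1 : g t * (r - t) = - (g t * (t - r)) by ring.
rewrite e1 in h1.
by move=> h3 h4; apply/andP; split; lra.
Qed.

Lemma bent_profile_bounds r : 0 <= r -> r / 2 <= p r <= r.
Proof.
by move=> r0; have := bent_profile_increment (lexx 0) r0; rewrite bent_profile0 !subr0.
Qed.

Lemma bent_profile_ge0 r : 0 <= r -> 0 <= p r.
Proof.
by move=> r0; have /andP[+ _] := bent_profile_bounds r0; apply: le_trans; rewrite divr_ge0.
Qed.

(** The dissipation when the step moves left by at most [q], used with [q] the
    square root of the step size. *)
Lemma tangent_defect_left q r t :
  0 <= q <= A -> r <= M -> r - q <= t -> t <= r -> 0 <= t ->
  p t <= p r + g r * (t - r) - k * (A - q + r) * (t - r) ^+ 2.
Proof.
have [A0' M0'] := (A0, M0); move=> /andP[q0 qA] rM qt tr t0.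
have := tangent_defect_small rM (le_trans tr rM).
suff : k * (A - q + r) * (t - r) ^+ 2 <= k * (t - r) ^+ 2 * (A + (t + 2 * r) / 3).
  by lra.
rewrite mulrAC; apply: ler_wpM2l; first by rewrite mulr_ge0// sqr_ge0.
by lra.
Qed.

(** The dissipation when the step moves right by at most [q].  The profile bends
    only up to [M], and [th] is the fraction of the excursion that is certain to
    stay below [M]. *)
Lemma tangent_defect_right th q r t :
  0 <= th <= 1 -> 0 <= r -> r <= M -> r <= t -> t <= r + q -> th * q <= M - r ->
  p t <= p r + g r * (t - r) - k * th * (A + r) * (t - r) ^+ 2.
Proof.
have [A0' M0'] := (A0, M0); move=> /andP[th0 th1] r0 rM rt tq thM.
have Ar : 0 <= A + r by rewrite addr_ge0.
have tr : 0 <= t - r by rewrite subr_ge0.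
have [tM|Mt] := leP t M.
  have := tangent_defect_small rM tM.
  suff : k * th * (A + r) * (t - r) ^+ 2 <= k * (t - r) ^+ 2 * (A + (t + 2 * r) / 3).
    by lra.
  have -> : k * th * (A + r) * (t - r) ^+ 2 = k * (t - r) ^+ 2 * (th * (A + r)) by ring.
  apply: ler_wpM2l; first by rewrite mulr_ge0// sqr_ge0.
  have : th * (A + r) <= 1 * (A + r) by rewrite ler_wpM2r.
  by lra.
have := tangent_defect_large rM (ltW Mt).
suff : k * th * (A + r) * (t - r) ^+ 2 <=
    k * (M - r) * ((M - r) * (A + (M + 2 * r) / 3) + (2 * A + M + r) * (t - M)).
  by lra.
have thtr : th * (t - r) <= M - r.
  by apply: le_trans thM; apply: ler_wpM2l => //; lra.
have -> : k * th * (A + r) * (t - r) ^+ 2 =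
   k * (th * (t - r)) * ((A + r) * (t - r)) by ring.
apply: ler_pM.
- by rewrite !mulr_ge0.
- by rewrite mulr_ge0.
- by apply: ler_wpM2l.
have e1 : (A + r) * (M - r) <= (M - r) * (A + (M + 2 * r) / 3).
  by rewrite mulrC ler_wpM2l ?subr_ge0//; lra.
have e2 : (A + r) * (t - M) <= (2 * A + M + r) * (t - M).
  by rewrite ler_wpM2r ?subr_ge0 ?(ltW Mt)//; lra.
by lra.
Qed.

Lemma tangent_defect_zero r : 0 <= r -> r <= M ->
  0 <= p r - g r * r - k * A * r ^+ 2.
Proof.
have [A0' M0'] := (A0, M0); move=> r0 rM; have := tangent_defect_small rM (ltW M0); rewrite bent_profile0.
have : k * A * r ^+ 2 <= k * (0 - r) ^+ 2 * (A + (0 + 2 * r) / 3).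
  rewrite sub0r sqrrN mulrAC; apply: ler_wpM2l; first by rewrite mulr_ge0// sqr_ge0.
  by lra.
by lra.
Qed.

End BentProfile.

(** * Gaussian expectations of functions of linear growth *)

(** Written against the Lebesgue measure, as in the definitions of [c0] and
    [p0]. *)
Definition gauss_mean (R : realType) (X : R -> R) : R :=
  \int[lebesgue_measure]_v (X v * normal_pdf 0 1 v).

(** A class of integrands that is stable under the operations below and contains
    the distance after a step, an affine function of the Gaussian. *)
Definition lin_growth (R : realType) (X : R -> R) : Prop :=
  measurable_fun setT X /\ exists C : R, forall v, `|X v| <= C * (1 + `|v|).

Lemma std_normal_pdfE (R : realType) (v : R) :
  normal_pdf 0 1 v = normal_peak 1 * expR (- v ^+ 2 / 2).
Proof. by rewrite normal_pdfE ?oner_eq0// /normal_fun subr0 expr1n. Qed.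

(** [1 + |v|] is at most [2 * expR (v ^+ 2 / 4)], which turns the standard
    density into a multiple of the density of variance 2. *)
Lemma integrable_gauss (R : realType) (X : R -> R) : lin_growth X ->
  lebesgue_measure.-integrable setT (fun v => (X v * normal_pdf 0 1 v)%:E).
Proof.
move=> [mX [C XC]].
have s2 : Num.sqrt 2 != 0 :> R by rewrite gt_eqF// sqrtr_gt0.
have C0 : 0 <= C.
  by have := XC 0; rewrite normr0 addr0 mulr1; apply: le_trans.
pose D := C * 2 * normal_peak 1 / normal_peak (Num.sqrt 2 : R).
have pk0 : 0 < normal_peak (Num.sqrt 2 : R) by exact: normal_peak_gt0.
have iD : lebesgue_measure.-integrable setT
    (fun v => (D * normal_pdf 0 (Num.sqrt 2) v)%:E).
  under eq_fun do rewrite EFinM.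
  by apply: integrableZl => //; exact: integrable_normal_pdf.
apply: le_integrable iD => //.
  apply/measurable_EFinP; apply: measurable_funM => //; exact: measurable_normal_pdf.
move=> v _ /=; rewrite lee_fin.
apply: le_trans (ler_norm _).
rewrite normrM (ger0_norm (normal_pdf_ge0 _ _ _)) std_normal_pdfE.
rewrite normal_pdfE// /normal_fun subr0 sqr_sqrtr// /D.
have -> : C * 2 * normal_peak 1 / normal_peak (Num.sqrt 2) *
    (normal_peak (Num.sqrt 2) * expR (- v ^+ 2 / (2 *+ 2))) =
    C * (2 * expR (v ^+ 2 / 4)) * (normal_peak 1 * expR (- v ^+ 2 / 2)).
  have -> : - v ^+ 2 / (2 *+ 2) = v ^+ 2 / 4 + - v ^+ 2 / 2 :> R.
    by rewrite -mulr_natr; field.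
  by rewrite expRD; field; rewrite gt_eqF.
apply: ler_wpM2r; first by rewrite mulr_ge0 ?expR_ge0 ?normal_peak_ge0.
apply: le_trans (XC v) _; apply: ler_wpM2l => //.
have := expR_ge1Dx (v ^+ 2 / 4); have := sqr_ge0 v.
have : 0 <= (`|v| - 2) ^+ 2 by rewrite sqr_ge0.
by rewrite sqrrB real_normK ?num_real//; lra.
Qed.

Lemma lin_growth_bounded (R : realType) (X : R -> R) (C : R) :
  measurable_fun setT X -> (forall v, `|X v| <= C) -> lin_growth X.
Proof.
move=> mX XC; split => //; exists C => v; apply: le_trans (XC v) _.
have C0 : 0 <= C by apply: le_trans (XC 0).
by rewrite ler_peMr// lerDl.
Qed.

Lemma lin_growth_cst (R : realType) (c : R) : lin_growth (fun=> c).
Proof. by apply: (@lin_growth_bounded _ _ `|c|). Qed.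

Lemma lin_growth_id (R : realType) : lin_growth (fun v : R => v).
Proof. by split => //; exists 1 => v; rewrite mul1r lerDr. Qed.

Lemma lin_growthD (R : realType) (X Y : R -> R) :
  lin_growth X -> lin_growth Y -> lin_growth (fun v => X v + Y v).
Proof.
move=> [mX [C XC]] [mY [D YD]]; split; first exact: measurable_funD.
exists (C + D) => v; apply: le_trans (ler_normD _ _) _.
by rewrite mulrDl; exact: lerD.
Qed.

Lemma lin_growthM (R : realType) (X Y : R -> R) :
  lin_growth X -> measurable_fun setT Y -> (forall v, `|Y v| <= 1) ->
  lin_growth (fun v => X v * Y v).
Proof.
move=> [mX [C XC]] mY Y1; split; first exact: measurable_funM.
by exists C => v; rewrite normrM; apply: le_trans (XC v); rewrite ler_piMr.
Qed.

Lemma lin_growthZ (R : realType) (c : R) (X : R -> R) :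
  lin_growth X -> lin_growth (fun v => c * X v).
Proof.
move=> [mX [C XC]]; split; first exact: measurable_funM.
by exists (`|c| * C) => v; rewrite normrM -mulrA ler_wpM2l.
Qed.

Lemma gauss_meanD (R : realType) (X Y : R -> R) : lin_growth X -> lin_growth Y ->
  gauss_mean (fun v => X v + Y v) = gauss_mean X + gauss_mean Y.
Proof.
move=> gX gY; rewrite /gauss_mean.
under eq_Rintegral do rewrite mulrDl.
by apply: RintegralD => //; exact: integrable_gauss.
Qed.

Lemma gauss_meanZ (R : realType) (c : R) (X : R -> R) : lin_growth X ->
  gauss_mean (fun v => c * X v) = c * gauss_mean X.
Proof.
move=> gX; rewrite /gauss_mean.
under eq_Rintegral do rewrite -mulrA.
by apply: RintegralZl => //; exact: integrable_gauss.
Qed.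

Lemma gauss_mean_le (R : realType) (X Y : R -> R) : lin_growth X -> lin_growth Y ->
  (forall v, X v <= Y v) -> gauss_mean X <= gauss_mean Y.
Proof.
move=> gX gY XY; apply: le_Rintegral => //; try exact: integrable_gauss.
by move=> v _; rewrite ler_wpM2r// normal_pdf_ge0.
Qed.

Lemma gauss_mean_cst (R : realType) (c : R) : gauss_mean (fun=> c) = c.
Proof.
rewrite /gauss_mean RintegralZl//; last exact: integrable_normal_pdf.
by rewrite /Rintegral integral_normal_pdf mulr1.
Qed.

Lemma gauss_mean_ge0 (R : realType) (X : R -> R) : (forall v, 0 <= X v) ->
  0 <= gauss_mean X.
Proof.
by move=> X0; apply: Rintegral_ge0 => v _; rewrite mulr_ge0// normal_pdf_ge0.
Qed.

Lemma gauss_mean_indic (R : realType) (A : set R) (X : R -> R) :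
  gauss_mean (fun v => X v * \1_A v) =
  \int[lebesgue_measure]_(v in A) (X v * normal_pdf 0 1 v).
Proof.
rewrite /gauss_mean [RHS]Rintegral_mkcond; apply: eq_Rintegral => v _.
by rewrite patchE indicE; case: (v \in A); rewrite ?mulr1// mulr0 mul0r.
Qed.

(** The exponential is the ratio of the Gaussian density at [- v - k] to the one
    at [v]; the map exchanging these points is an involution that preserves the
    Lebesgue measure. *)
Lemma gauss_mean_reflect (R : realType) (k : R) (X : R -> R) :
  measurable_fun setT X -> (forall v, 0 <= X v) ->
  gauss_mean (fun v => X v * expR (- (k * (k + 2 * v)) / 2)) =
  gauss_mean (fun v => X (- v - k)).
Proof.
move=> mX X0; rewrite /gauss_mean.
have mXp : measurable_fun setT (fun v : R => (X (- v - k) * normal_pdf 0 1 v)%:E).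
  apply/measurable_EFinP; apply: measurable_funM; last exact: measurable_normal_pdf.
  apply: measurableT_comp => //; apply: measurable_funB => //.
have Xp0 v : (0 <= (X (- v - k) * normal_pdf 0 1 v)%:E)%E.
  by rewrite lee_fin mulr_ge0// normal_pdf_ge0.
have N10 : (-1 : R) != 0 by rewrite oppr_eq0 oner_eq0.
have := ge0_integral_affine (- k) N10 mXp Xp0.
rewrite normrN1 invr1 mul1e /Rintegral => <-; congr fine.
apply: eq_integral => v _; congr (_%:E).
rewrite !std_normal_pdfE mulN1r opprD !opprK addrK -mulrA; congr (_ * _).
rewrite mulrCA; congr (_ * _); rewrite -expRD; congr expR.
by field.
Qed.

(** * The rejection probability *)

(** The rejection probability given the component [v] of the noise along the
    line of the two Euler points, at distance [k] in units of the square root of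
    the step size. *)
Definition reject (R : realType) (k v : R) : R :=
  Num.max 0 (1 - expR (- (k * (k + 2 * v)) / 2)).

Lemma gauss_mean_id (R : realType) : gauss_mean (fun v : R => v) = 0.
Proof.
pose P (v : R) := Num.max 0 v.
have mP : measurable_fun setT P by exact: measurable_maxr.
have P0 v : 0 <= P v by rewrite le_max lexx.
have gP : lin_growth P.
  split=> //; exists 1 => v; rewrite mul1r ger0_norm// /P ge_max; apply/andP; split.
    by rewrite addr_ge0.
  by apply: le_trans (ler_norm v) _; rewrite lerDr.
have gN : lin_growth (fun v => P (- v - 0)).
  case: gP => _ [C CP]; split.
    by apply: measurableT_comp => //; apply: measurable_funB.
  by exists C => v; have := CP (- v - 0); rewrite subr0 normrN.
have := gauss_mean_reflect 0 mP P0.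
have -> : (fun v => P v * expR (- (0 * (0 + 2 * v)) / 2)) = P.
  by apply/funext => v; rewrite mul0r oppr0 mul0r expR0 mulr1.
move=> e.
transitivity (gauss_mean (fun v => P v + -1 * P (- v - 0))).
  congr gauss_mean; apply/funext => v; rewrite subr0 /P.
  by have [v0|v0] := leP 0 v; have [w0|w0] := leP 0 (- v); lra.
rewrite gauss_meanD//; last exact: lin_growthZ.
by rewrite gauss_meanZ// -e mulN1r subrr.
Qed.

Section Reject.
Variables (R : realType) (k : R).
Hypothesis k0 : 0 <= k.

Lemma reject_ge0 v : 0 <= reject k v.
Proof. by rewrite /reject le_max lexx. Qed.

Lemma reject_le1 v : reject k v <= 1.
Proof. by rewrite /reject ge_max ler01 gerBl expR_ge0. Qed.

Lemma norm_reject_le1 v : `|reject k v| <= 1.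
Proof. by rewrite ger0_norm ?reject_ge0// reject_le1. Qed.

Lemma measurable_reject : measurable_fun setT (reject k).
Proof.
apply: measurable_maxr => //; apply: measurable_funB => //.
apply: measurableT_comp => //; apply: measurable_funM => //.
apply: measurableT_comp => //; apply: measurable_funM => //.
by apply: measurable_funD => //; apply: measurable_funM.
Qed.

Lemma reject_ge v : 1 - expR (- (k * (k + 2 * v)) / 2) <= reject k v.
Proof. by rewrite /reject le_max lexx orbT. Qed.

Lemma reject_eq0 v : k + 2 * v <= 0 -> reject k v = 0.
Proof.
move=> v0; apply: max_l; rewrite subr_le0 -[leLHS]expR0 ler_expR mulNr oppr_ge0.
by rewrite mulr_le0_ge0// mulr_ge0_le0.
Qed.

Lemma rejectE v : 0 <= k + 2 * v ->
  reject k v = 1 - expR (- (k * (k + 2 * v)) / 2).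
Proof.
move=> v0; apply: max_r; rewrite subr_ge0 -[leRHS]expR0 ler_expR mulNr oppr_le0.
by rewrite divr_ge0// mulr_ge0.
Qed.

Lemma lin_growth_reject : lin_growth (reject k).
Proof. exact: (lin_growth_bounded measurable_reject norm_reject_le1). Qed.

Lemma lin_growth_distance : lin_growth (fun v : R => k + 2 * v).
Proof.
by apply: lin_growthD; [exact: lin_growth_cst|exact/lin_growthZ/lin_growth_id].
Qed.

(** On the half line where the distance is positive, [1 - reject k v] is the
    ratio of the mirrored Gaussian to the Gaussian; acceptance thus removes from
    the mean of the positive part of [k + 2 * v] exactly that of the negative
    part, and the mean of [k + 2 * v], which is [k], is left. *)
Lemma gauss_mean_distance :
  gauss_mean (fun v => (k + 2 * v) * reject k v) = k.
Proof.
pose P (v : R) := Num.max 0 (k + 2 * v).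
have mP : measurable_fun setT P.
  apply: measurable_maxr => //; have [m _] := lin_growth_distance; exact: m.
have P0 v : 0 <= P v by rewrite le_max lexx.
have gP : lin_growth P.
  have [_ [C CP]] := lin_growth_distance; split=> //; exists C => v.
  rewrite ger0_norm// /P ge_max (le_trans _ (CP v))//=.
  by rewrite (le_trans _ (CP v))// ler_norm.
have gP' : lin_growth (fun v => P v * (1 - reject k v)).
  apply: lin_growthM => //.
    by apply: measurable_funB => //; exact: measurable_reject.
  by move=> v; have := reject_ge0 v; have := reject_le1 v => *;
    rewrite ger0_norm ?subr_ge0// gerBl.
have gN : lin_growth (fun v => P (- v - k)).
  have [_ [C CP]] := lin_growth_distance; split.
    by apply: measurableT_comp => //; apply: measurable_funB.
  exists C => v; rewrite ger0_norm// /P (_ : k + 2 * (- v - k) = - (k + 2 * v)); last by ring.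
  rewrite ge_max (le_trans _ (CP v))//= (le_trans _ (CP v))//.
  by rewrite -normrN ler_norm.
transitivity (gauss_mean (fun v => P v + -1 * (P v * (1 - reject k v)))).
  congr gauss_mean; apply/funext => v; rewrite /P.
  by have [v0|v0] := leP 0 (k + 2 * v); [ring|rewrite (reject_eq0 (ltW v0)); ring].
rewrite gauss_meanD//; last exact: lin_growthZ.
rewrite gauss_meanZ//.
have -> : gauss_mean (fun v => P v * (1 - reject k v)) = gauss_mean (fun v => P (- v - k)).
  rewrite -gauss_mean_reflect//; congr gauss_mean; apply/funext => v; rewrite /P.
  have [v0|v0] := leP 0 (k + 2 * v); last by rewrite !mul0r.
  by rewrite rejectE//; ring.
rewrite -gauss_meanZ// -gauss_meanD//; last exact: lin_growthZ.
transitivity (gauss_mean (fun v => k + 2 * v)).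
  congr gauss_mean; apply/funext => v; rewrite /P.
  rewrite (_ : k + 2 * (- v - k) = - (k + 2 * v)); last by ring.
  by have [v0|v0] := leP 0 (k + 2 * v); have [w0|w0] := leP 0 (- (k + 2 * v)); lra.
rewrite gauss_meanD; [|exact: lin_growth_cst|exact/lin_growthZ/lin_growth_id].
by rewrite gauss_mean_cst gauss_meanZ ?gauss_mean_id ?mulr0 ?addr0//; exact: lin_growth_id.
Qed.

Lemma gauss_mean_reject_le1 : gauss_mean (reject k) <= 1.
Proof.
rewrite -(gauss_mean_cst 1); apply: gauss_mean_le => //; first exact: lin_growth_reject.
  exact: lin_growth_cst.
exact: reject_le1.
Qed.

(** The probability that the chains meet dominates the mean of any minorant of
    the acceptance probability. *)
Lemma gauss_mean_accept (X : R -> R) :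
  lin_growth X -> (forall v, X v <= 1 - reject k v) ->
  gauss_mean X <= 1 - gauss_mean (reject k).
Proof.
move=> gX Xr; rewrite lerBrDr -gauss_meanD//; last exact: lin_growth_reject.
rewrite -(gauss_mean_cst 1); apply: gauss_mean_le.
- by apply: lin_growthD => //; exact: lin_growth_reject.
- exact: lin_growth_cst.
- by move=> v; rewrite -lerBrDr.
Qed.

End Reject.

Lemma lin_growth_on (R : realType) (i : interval R) (X : R -> R) (C : R) :
  measurable_fun setT X -> 0 <= C -> (forall v, v \in i -> `|X v| <= C) ->
  lin_growth (fun v => X v * \1_[set` i] v).
Proof.
move=> mX C0 XC; apply: (@lin_growth_bounded _ _ C).
  by apply: measurable_funM => //; exact: measurable_indic.
move=> v; rewrite indicE; have [vi|vi] := boolP (v \in i).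
  by rewrite mem_set// mulr1 XC.
by rewrite memNset ?mulr0 ?normr0//; exact/negP.
Qed.

Lemma gauss_mean_opp (R : realType) (X : R -> R) :
  measurable_fun setT X -> (forall v, 0 <= X v) ->
  gauss_mean (fun v => X (- v)) = gauss_mean X.
Proof.
move=> mX X0; have := gauss_mean_reflect 0 mX X0.
have -> : (fun v => X v * expR (- (0 * (0 + 2 * v)) / 2)) = X.
  by apply/funext => v; rewrite mul0r oppr0 mul0r expR0 mulr1.
by move=> ->; congr gauss_mean; apply/funext => v; rewrite subr0.
Qed.

Lemma c0E (R : realType) : c0 R = 4 * Num.min
  (gauss_mean (fun u => u ^+ 2 * (1 - expR (u - 2^-1)) * \1_`[0, 2^-1] u))
  ((1 - expR (- 1)) * gauss_mean (fun u => u ^+ 3 * \1_`[0, 2^-1] u)).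
Proof. by rewrite /c0 /= !gauss_mean_indic. Qed.

Lemma p0E (R : realType) : p0 R = gauss_mean (fun u => 1 * \1_`[1, +oo[ u).
Proof. by rewrite gauss_mean_indic; apply: eq_Rintegral => v _; rewrite mul1r. Qed.

Lemma p0_ge0 (R : realType) : 0 <= p0 R.
Proof. by rewrite p0E; apply: gauss_mean_ge0 => v; rewrite mul1r. Qed.

Lemma lin_growth_cut (R : realType) (n : nat) (X : R -> R) :
  measurable_fun setT X -> (forall v, 0 <= v <= 2^-1 -> 0 <= X v <= 1) ->
  lin_growth (fun v => v ^+ n * X v * \1_`[0, 2^-1] v).
Proof.
move=> mX X1; apply: (@lin_growth_on _ _ _ 1) => //.
  by apply: measurable_funM.
move=> v; rewrite in_itv/= => v1; have /andP[X0 X1'] := X1 v v1.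
case/andP: v1 => v0 v2; rewrite normrM normrX !ger0_norm//.
rewrite -[leRHS]mulr1; apply: ler_pM => //; first exact: exprn_ge0.
by apply: exprn_ile1 => //; apply: le_trans v2 _; lra.
Qed.

(** * The constants [c0] and [p0] *)

(** The chord of a concave function on [[0, 1]]. *)
Lemma oneBexpR_concave (R : realType) (x : R) : 0 <= x <= 1 ->
  (1 - expR (- 1)) * x <= 1 - expR (- x).
Proof.
move=> x01; pose t := Itv01 (andP x01).1 (andP x01).2.
have := convex_expR t (- 1) 0.
rewrite !convRE /= expR0 !mulr0 addr0 mulr1 mulrN1.
by rewrite /unstable.onem; lra.
Qed.

Lemma c0_integrand_bounds (R : realType) (u : R) : 0 <= u <= 2^-1 ->
  0 <= 1 - expR (u - 2^-1) <= 2^-1 - u.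
Proof.
move=> /andP[u0 u2]; have := expR_ge1Dx (u - 2^-1).
have : expR (u - 2^-1) <= 1 by rewrite -[leRHS]expR0 ler_expR; lra.
by move=> *; apply/andP; split; lra.
Qed.

Lemma lin_growth_c0_left (R : realType) :
  lin_growth (fun u : R => u ^+ 2 * (1 - expR (u - 2^-1)) * \1_`[0, 2^-1] u).
Proof.
apply: lin_growth_cut.
  by apply: measurable_funB => //; apply: measurableT_comp => //; apply: measurable_funB.
by move=> v v1; have /andP[-> h] := c0_integrand_bounds v1; case/andP: v1 => ? ?; lra.
Qed.

Lemma lin_growth_c0_right (R : realType) :
  lin_growth (fun u : R => u ^+ 3 * \1_`[0, 2^-1] u).
Proof.
have -> : (fun u : R => u ^+ 3 * \1_`[0, 2^-1] u) =
    (fun u => u ^+ 3 * 1 * \1_`[0, 2^-1] u).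
  by apply/funext => u; rewrite mulr1.
by apply: lin_growth_cut => // v _; rewrite ler01 lexx.
Qed.

Lemma c0_le_left (R : realType) : c0 R <= 4 * gauss_mean
  (fun u => u ^+ 2 * (1 - expR (u - 2^-1)) * \1_`[0, 2^-1] u).
Proof. by rewrite c0E ler_wpM2l// ge_min lexx. Qed.

Lemma c0_le_right (R : realType) : c0 R <= 4 * ((1 - expR (- 1)) *
  gauss_mean (fun u => u ^+ 3 * \1_`[0, 2^-1] u)).
Proof. by rewrite c0E ler_wpM2l// ge_min lexx orbT. Qed.

Lemma indic_itv (R : realType) (i : interval R) (v : R) :
  \1_[set` i] v = (v \in i)%:R :> R.
Proof.
rewrite indicE; have [vi|vi] := boolP (v \in i); first by rewrite mem_set.
by rewrite memNset//; exact/negP.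
Qed.

(** For [0 <= v], rejection has probability at least [1 - expR (- (k * v))],
    which is linear in [k * v] up to the chord constant of [oneBexpR_concave]. *)
Lemma reject_above (R : realType) (k : R) : 0 <= k <= 1 ->
  c0 R * k <= 4 * gauss_mean (fun v => v ^+ 2 * reject k v * \1_`[0, 2^-1] v).
Proof.
move=> /andP[k0 k1].
apply: le_trans (ler_wpM2r k0 (c0_le_right R)) _.
rewrite -mulrA ler_wpM2l// mulrAC -gauss_meanZ; last exact: lin_growth_c0_right.
apply: gauss_mean_le; [exact/lin_growthZ/lin_growth_c0_right| |].
  apply: lin_growth_cut; first exact: measurable_reject.
  by move=> v _; rewrite reject_ge0 reject_le1.
move=> v; rewrite !indic_itv in_itv/=.
case: (boolP (0 <= v <= 2^-1)) => [/andP[v0 v1]|_]; last by rewrite !mulr0.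
rewrite !mulr1 exprS mulrA [leRHS]mulrC ler_wpM2r ?sqr_ge0//.
apply: le_trans (reject_ge _ _).
have kv : 0 <= k * v <= 1.
  by rewrite mulr_ge0//= mulr_ile1//; lra.
rewrite -mulrA; apply: le_trans (oneBexpR_concave kv) _.
by rewrite lerD2l lerN2 ler_expR; have := sqr_ge0 k; lra.
Qed.

(** For [1 <= k] and [v] in [[-1/2, 0]], the exponent [k * (k + 2 * v) / 2] is
    at least [2^-1 + v]. *)
Lemma reject_below (R : realType) (k : R) : 1 <= k ->
  c0 R <= 4 * gauss_mean (fun v => v ^+ 2 * reject k v * \1_`[- 2^-1, 0] v).
Proof.
move=> k1; apply: le_trans (c0_le_left R) _; rewrite ler_wpM2l//.
rewrite -[leRHS]gauss_mean_opp; last 2 first.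
- apply: measurable_funM; last exact: measurable_indic.
  by apply: measurable_funM => //; exact: measurable_reject.
- by move=> v; rewrite mulr_ge0// mulr_ge0 ?sqr_ge0// reject_ge0.
have e : (fun v : R => (- v) ^+ 2 * reject k (- v) * \1_`[- 2^-1, 0] (- v)) =
  (fun v => v ^+ 2 * reject k (- v) * \1_`[0, 2^-1] v).
  apply/funext => v; rewrite sqrrN; congr (_ * _).
  by rewrite !indic_itv !in_itv/= lerN2 oppr_le0 andbC.
rewrite e; apply: gauss_mean_le; first exact: lin_growth_c0_left.
  apply: lin_growth_cut.
    by apply: measurableT_comp; [exact: measurable_reject|exact: measurable_funN].
  by move=> v _; rewrite reject_ge0 reject_le1.
move=> v; rewrite !indic_itv in_itv/=.
case: (boolP (0 <= v <= 2^-1)) => [/andP[v0 v1]|_]; last by rewrite !mulr0.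
rewrite !mulr1 ler_wpM2l ?sqr_ge0//; apply: le_trans (reject_ge _ _).
rewrite lerD2l lerN2 ler_expR.
have : 1 * (1 - 2 * v) <= k * (k - 2 * v) by apply: ler_pM; lra.
by lra.
Qed.

(** If [k <= 1], then [v <= -1] forces [k + 2 * v <= 0], where acceptance is
    certain. *)
Lemma p0_le_accept (R : realType) (k : R) : 0 <= k <= 1 ->
  p0 R <= 1 - gauss_mean (reject k).
Proof.
move=> /andP[k0 k1]; rewrite p0E -gauss_mean_opp.
- apply: gauss_mean_accept => //.
    have -> : (fun v : R => 1 * \1_`[1, +oo[ (- v)) =
        (fun v : R => 1 * \1_`]-oo, (- 1)] v : R).
      by apply/funext => v; rewrite !indic_itv !in_itv/= andbT lerNr.
    by apply: (@lin_growth_on _ _ _ 1) => // v _; rewrite normr1.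
  move=> v; rewrite mul1r indic_itv in_itv/= andbT.
  have [v1|v1] := leP 1 (- v); last by rewrite subr_ge0 reject_le1.
  by rewrite reject_eq0 ?subr0//; lra.
- by apply: measurable_funM => //; exact: measurable_indic.
- by move=> v; rewrite mul1r.
Qed.

Lemma p0_le1 (R : realType) : p0 R <= 1.
Proof.
have := @p0_le_accept R 0; rewrite lexx ler01 => /(_ isT).
have := gauss_mean_ge0 (@reject_ge0 R 0); lra.
Qed.

(** Both sides are compared on [[0, 1/2]], where the acceptance probability is
    at least [expR (- 1)]. *)
Lemma c0_le_accept (R : realType) (k : R) : 0 <= k <= 1 ->
  c0 R <= 1 - gauss_mean (reject k).
Proof.
move=> /andP[k0 k1]; apply: le_trans (c0_le_left R) _.
rewrite -gauss_meanZ; last exact: lin_growth_c0_left.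
apply: gauss_mean_accept => //; first exact/lin_growthZ/lin_growth_c0_left.
move=> v; rewrite indic_itv in_itv/=.
have [v01|_] := boolP (0 <= v <= 2^-1); last by rewrite !mulr0 subr_ge0 reject_le1.
have /andP[c1 c2] := c0_integrand_bounds v01; case/andP: v01 => v0 v1.
rewrite mulr1 rejectE//; last by lra.
(* Four times the integrand is at most 1/4, and the acceptance probability is
   at least [expR (- 1)], which exceeds 1/4. *)
rewrite subKr; apply: (@le_trans _ _ 4^-1).
  have : v ^+ 2 * (1 - expR (v - 2^-1)) <= v ^+ 2 * (2^-1 - v).
    by rewrite ler_wpM2l// sqr_ge0.
  have : v * (v * (2^-1 - v)) <= 2^-1 * 8^-1.
    apply: ler_pM => //; first by rewrite mulr_ge0//; lra.
    by have := sqr_ge0 (v - 4^-1); lra.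
  by lra.
apply: (@le_trans _ _ (expR (- 1))).
  have -> : - 1 = - 2^-1 + - 2^-1 :> R by field.
  rewrite expRD; have := expR_ge1Dx (- 2^-1 : R) => h.
  have h' : 2^-1 <= expR (- 2^-1 : R) by lra.
  have : 2^-1 * 2^-1 <= expR (- 2^-1) * expR (- 2^-1 : R) by apply: ler_pM.
  by lra.
rewrite ler_expR.
have : k * (k + 2 * v) <= 1 * 2 by apply: ler_pM; lra.
by lra.
Qed.

Lemma gauss_mean_gt0 (R : realType) (X : R -> R) (m : R) : lin_growth X ->
  0 < m -> (forall v, 0 <= X v) -> (forall v, 8^-1 <= v <= 4^-1 -> m <= X v) ->
  0 < gauss_mean X.
Proof.
move=> gX m0 X0 Xm.
pose D : R := normal_peak 1 * expR (- 1).
have D0 : 0 < D by rewrite mulr_gt0 ?expR_gt0// normal_peak_gt0.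
have iS : lebesgue_measure.-integrable setT
    (fun v : R => (m * \1_`[8^-1, 4^-1] v * normal_pdf 0 1 v)%:E).
  apply: integrable_gauss; apply: (@lin_growth_on _ _ (fun=> m) `|m|) => //.
apply: (@lt_le_trans _ _ (gauss_mean (fun v => m * \1_`[8^-1, 4^-1] v))); last first.
  apply: gauss_mean_le => //.
    by apply: (@lin_growth_on _ _ (fun=> m) `|m|).
  move=> v; rewrite indic_itv in_itv/=.
  by case: (boolP (8^-1 <= v <= 4^-1)) => [/Xm|_]; rewrite ?mulr1// mulr0.
rewrite gauss_mean_indic.
apply: (@lt_le_trans _ _ (\int[lebesgue_measure]_(v in (`[8^-1, 4^-1]%classic : set R)) (m * D))).
  rewrite Rintegral_cst// mulr_gt0//; first exact: mulr_gt0.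
  have : 0 < fine (lebesgue_measure (`[8^-1, 4^-1]%classic : set R)).
    rewrite lebesgue_measure_itv/= lte_fin ifT; last by lra.
    by rewrite -EFinB /=; lra.
  by [].
apply: le_Rintegral => //.
- by apply: continuous_compact_integrable; [exact: segment_compact|
    apply: continuous_subspaceT => x; exact: cvg_cst].
- apply: (@integrableS _ _ _ _ setT) => //.
  by apply: integrable_gauss; exact: lin_growth_cst.
move=> v /=; rewrite in_itv/= => /andP[v8 v4]; rewrite ler_wpM2l ?(ltW m0)//.
rewrite std_normal_pdfE ler_wpM2l ?normal_peak_ge0// ler_expR mulNr lerN2.
have : v * v <= 4^-1 * 4^-1 by apply: ler_pM => //; lra.
by rewrite -expr2; lra.
Qed.

Lemma c0_gt0 (R : realType) : 0 < c0 R.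
Proof.
rewrite c0E mulr_gt0// lt_min; apply/andP; split.
  have e4 : 0 < 1 - expR (- 4^-1 : R).
    by rewrite subr_gt0 -[ltRHS]expR0 ltr_expR; lra.
  apply: (@gauss_mean_gt0 _ _ (64^-1 * (1 - expR (- 4^-1)))).
  - exact: lin_growth_c0_left.
  - by rewrite mulr_gt0.
  - move=> v; rewrite indic_itv in_itv/=.
    have [v01|_] := boolP (0 <= v <= 2^-1); last by rewrite mulr0.
    by rewrite mulr1 mulr_ge0 ?sqr_ge0//; have /andP[] := c0_integrand_bounds v01.
  - move=> v /andP[v8 v4]; rewrite indic_itv in_itv/=.
    have -> : (0 <= v <= 2^-1) = true by apply/andP; split; lra.
    rewrite mulr1; apply: ler_pM; [by []|exact: ltW e4| |].
      have : 8^-1 * 8^-1 <= v * v by apply: ler_pM => //; lra.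
      by rewrite expr2; lra.
    by rewrite lerD2l lerN2 ler_expR; lra.
have e1 : 0 < 1 - expR (- 1 : R) by rewrite subr_gt0 -[ltRHS]expR0 ltr_expR; lra.
rewrite mulr_gt0//; apply: (@gauss_mean_gt0 _ _ (8^-1 ^+ 3)).
- exact: lin_growth_c0_right.
- by rewrite exprn_gt0.
- move=> v; rewrite indic_itv in_itv/=.
  have [/andP[v0 _]|_] := boolP (0 <= v <= 2^-1); last by rewrite mulr0.
  by rewrite mulr1 exprn_ge0.
- move=> v /andP[v8 v4]; rewrite indic_itv in_itv/=.
  have -> : (0 <= v <= 2^-1) = true by apply/andP; split; lra.
  by rewrite mulr1 lerXn2r// nnegrE; lra.
Qed.

(** * One step of the chain *)

(** The metric as a function of the Euclidean distance, set to 0 on the negative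
    half line so as to be measurable and nonnegative on the whole line. *)
Definition cost (R : realType) (a k A M t : R) : R :=
  (a + bent_profile k A M t) * \1_`]0, +oo[ t.

Lemma measurable_cost (R : realType) (a k A M : R) :
  measurable_fun setT (cost a k A M).
Proof.
have mm : measurable_fun setT (fun t : R => Num.min t M).
  by apply: measurable_minr.
apply: measurable_funM; last exact: measurable_indic.
apply: measurable_funD => //; apply: measurable_funD.
  apply: measurable_funB => //; apply: measurable_funM => //; apply: measurable_funD.
    by apply: measurable_funM => //; exact: measurable_funX.
  by apply: measurable_funM => //; exact: measurable_funX.
apply: measurable_funM; last exact: measurable_funB.
apply: measurable_funB => //; apply: measurable_funM => //; apply: measurable_funD.
  exact: measurable_funM.
exact: measurable_funX.
Qed.

Lemma cost0 (R : realType) (a k A M : R) : cost a k A M 0 = 0.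
Proof. by rewrite /cost indic_itv in_itv/= ltxx mulr0. Qed.

Lemma cost_pos (R : realType) (a k A M t : R) : 0 < t ->
  cost a k A M t = a + bent_profile k A M t.
Proof. by move=> t0; rewrite /cost indic_itv in_itv/= t0 mulr1. Qed.

Lemma rhoE (R : realType) (d : nat) (h M a : R) (x y : 'cV[R]_d) :
  0 < h -> a = 0 \/ Num.sqrt h <= a -> 0 < M ->
  rho h M a x y =
  cost a (bending h M a) (a + Num.sqrt h) M (enorm (x - y)).
Proof.
move=> h0 ah M0; rewrite /rho (f_funE h0 (c0_gt0 R) ah (ltW M0) (enorm_ge0 _)).
have := enorm_ge0 (x - y); rewrite le_eqVlt => /predU1P[e|e].
  have /eqP : enorm (x - y) == 0 by rewrite -e.
  move=> e0; move: (enorm_eq0 (x - y)); rewrite e0 eqxx => /esym.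
  by rewrite subr_eq0 => /eqP ->; rewrite eqxx cost0 bent_profile0// mulr0 addr0.
rewrite cost_pos// (_ : x != y) ?mulr1//.
by rewrite -subr_eq0 -enorm_eq0 gt_eqF.
Qed.

Section OneStep.
Variables (R : realType) (k A M a s r : R).
Hypotheses (k0 : 0 <= k) (A0 : 0 <= A) (M0 : 0 < M).
Hypothesis kM : k * (2 * A * M + M ^+ 2) <= 2^-1.
Hypotheses (a0 : 0 <= a) (s0 : 0 < s) (r0 : 0 <= r).
Local Notation p := (bent_profile k A M).
Local Notation g := (bent_slope k A M).
Local Notation w := (reject (r / s)).
Local Notation t v := (r + 2 * s * v).

Lemma cost_ge0 u : 0 <= cost a k A M u.
Proof.
rewrite /cost indic_itv in_itv/= andbT; have [u0|_] := ltP 0 u; last by rewrite mulr0.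
by rewrite mulr1 addr_ge0// bent_profile_ge0// ltW.
Qed.

Lemma distanceE v : t v = s * (r / s + 2 * v).
Proof. by field; rewrite gt_eqF. Qed.

(** The tangent of the profile at [r] is integrated against the law of the next
    distance, whose mean is [r].  It exceeds the profile by at least [B] after a
    rejected step, and by at least [delta] at 0, where an accepted step leads. *)
Lemma coupled_cost_bound (B : R -> R) (delta : R) :
  lin_growth (fun v => B v * w v) ->
  (forall v, 0 < t v -> p (t v) <= p r + g r * (t v - r) - B v) ->
  0 <= p r - g r * r - delta ->
  (\int[lebesgue_measure]_v (cost a k A M `|t v| * w v * normal_pdf 0 1 v)%:E <=
   (p r + a * gauss_mean w - delta * (1 - gauss_mean w) -
    gauss_mean (fun v => B v * w v))%:E)%E.
Proof.
move=> gB tangent zero; set q := p r - g r * r - delta in zero.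
have rs0 : 0 <= r / s by rewrite divr_ge0// ltW.
pose Y v := ((a + delta) * w v + q) +
  (g r * s * ((r / s + 2 * v) * w v) + -1 * (B v * w v)).
have gw : lin_growth w by exact: lin_growth_reject.
have gd : lin_growth (fun v => (r / s + 2 * v) * w v).
  apply: lin_growthM; [exact: lin_growth_distance|exact: measurable_reject|].
  exact: norm_reject_le1.
have gY1 : lin_growth (fun v => (a + delta) * w v + q).
  by apply: lin_growthD; [exact: lin_growthZ|exact: lin_growth_cst].
have gY2 : lin_growth (fun v => g r * s * ((r / s + 2 * v) * w v) + -1 * (B v * w v)).
  by apply: lin_growthD; exact: lin_growthZ.
have gY : lin_growth Y by exact: lin_growthD.
have mY : gauss_mean Y = p r + a * gauss_mean w - delta * (1 - gauss_mean w) -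
    gauss_mean (fun v => B v * w v).
  rewrite /Y gauss_meanD// gauss_meanD; [|exact: lin_growthZ|exact: lin_growth_cst].
  rewrite gauss_mean_cst gauss_meanD; [|exact: lin_growthZ|exact: lin_growthZ].
  rewrite !gauss_meanZ// gauss_mean_distance// /q.
  by field; rewrite gt_eqF.
have costY v : cost a k A M `|t v| * w v <= Y v.
  have w0 := reject_ge0 (r / s) v; have w1 := reject_le1 (r / s) v.
  have [tv|tv] := leP (t v) 0.
    rewrite /Y reject_eq0// ?mulr0 ?addr0 ?add0r//.
    by rewrite distanceE pmulr_rle0 in tv.
  rewrite gtr0_norm// cost_pos//.
  have h1 : w v * p (t v) <= w v * (p r + g r * (t v - r) - B v).
    by apply: ler_wpM2l => //; exact: tangent.
  have h2 : 0 <= (1 - w v) * q by rewrite mulr_ge0// subr_ge0.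
  have -> : Y v = (a + delta) * w v + q + (g r * t v * w v - B v * w v).
    by rewrite /Y distanceE; ring.
  move: h1 h2; rewrite /q; lra.
rewrite -mY /gauss_mean /Rintegral fineK; last first.
  by apply: integrable_fin_num => //; exact: integrable_gauss.
apply: ge0_le_integral => //.
- move=> v _; rewrite lee_fin; apply: mulr_ge0; last exact: normal_pdf_ge0.
  by apply: mulr_ge0; [exact: cost_ge0|exact: reject_ge0].
- apply/measurable_EFinP; apply: measurable_funM; last exact: measurable_normal_pdf.
  apply: measurable_funM; last exact: measurable_reject.
  apply: measurableT_comp; first exact: measurable_cost.
  apply: measurableT_comp => //; apply: measurable_funD => //; exact: measurable_funM.
- by have /measurable_int := integrable_gauss gY.
- by move=> v _; rewrite lee_fin ler_wpM2r ?normal_pdf_ge0.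
Qed.

Local Notation step :=
  (\int[lebesgue_measure]_v (cost a k A M `|t v| * w v * normal_pdf 0 1 v)%:E)%E.

Lemma step_le : (step <= (a * gauss_mean w + p r)%:E)%E.
Proof.
have := @coupled_cost_bound (fun=> 0) 0.
have -> : (fun v => 0 * w v) = (fun=> 0) by apply/funext => v; rewrite mul0r.
rewrite gauss_mean_cst => H; apply: le_trans (H _ _ _) _.
- exact: lin_growth_cst.
- by move=> v tv; rewrite subr0; apply: bent_profile_tangent => //; exact: ltW.
- have := bent_profile_tangent k0 A0 M0 r0 (lexx 0); rewrite bent_profile0//; lra.
- by rewrite lee_fin; lra.
Qed.

(** The defect of the tangent is used for [v] in [i] only; elsewhere concavity
    suffices. *)
Lemma step_le_dissipation (i : interval R) (c : R) :
  0 <= c -> (forall v, v \in i -> v ^+ 2 <= 1) ->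
  (forall v, v \in i -> 0 < t v ->
     p (t v) <= p r + g r * (t v - r) - c * (t v - r) ^+ 2) ->
  (step <= (a + p r - c * s ^+ 2 *
      (4 * gauss_mean (fun v => v ^+ 2 * w v * \1_[set` i] v)))%:E)%E.
Proof.
move=> c00 i1 ti.
have rs0 : 0 <= r / s by rewrite divr_ge0// ltW.
have gi : lin_growth (fun v => v ^+ 2 * w v * \1_[set` i] v).
  apply: (@lin_growth_on _ _ _ 1) => //.
    by apply: measurable_funM => //; exact: measurable_reject.
  move=> v vi; rewrite normrM; apply: mulr_ile1 => //.
    by rewrite ger0_norm ?sqr_ge0// i1.
  exact: norm_reject_le1.
pose B v := c * s ^+ 2 * 4 * v ^+ 2 * \1_[set` i] v.
have BwE : (fun v => B v * w v) =
    (fun v => c * s ^+ 2 * 4 * (v ^+ 2 * w v * \1_[set` i] v)).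
  by apply/funext => v; rewrite /B; ring.
have := @coupled_cost_bound B 0; rewrite BwE gauss_meanZ// => H.
apply: le_trans (H _ _ _) _.
- exact: lin_growthZ.
- move=> v tv; rewrite /B indic_itv; have [vi|_] := boolP (v \in i).
    have := ti v vi tv; rewrite mulr1.
    by rewrite (_ : c * (t v - r) ^+ 2 = c * s ^+ 2 * 4 * v ^+ 2); last by ring.
  by rewrite mulr0 subr0; apply: bent_profile_tangent => //; exact: ltW.
- have := bent_profile_tangent k0 A0 M0 r0 (lexx 0); rewrite bent_profile0//; lra.
rewrite lee_fin mul0r subr0 [X in _ <= X - _]addrC -!mulrA lerD2r lerD2l.
by rewrite ler_piMr// gauss_mean_reject_le1.
Qed.

Lemma step_le_below : 0 <= s <= A -> s <= r -> r <= M ->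
  (step <= (a + p r - k * (A - s + r) * s ^+ 2 * c0 R)%:E)%E.
Proof.
move=> sA sr rM; have /andP[_ sA'] := sA.
have c00 : 0 <= k * (A - s + r) by rewrite mulr_ge0// addr_ge0// subr_ge0.
apply: le_trans (step_le_dissipation (i := `[- 2^-1, 0]) c00 _ _) _.
- move=> v; rewrite in_itv/= => /andP[v1 v2]; rewrite -sqrrN exprn_ile1//; lra.
- move=> v; rewrite in_itv/= => /andP[v1 v2] tv.
  have sv : s * (- 2^-1) <= s * v by rewrite ler_wpM2l// ltW.
  have sv0 : s * v <= 0 by rewrite mulr_ge0_le0// ltW.
  by apply: tangent_defect_left => //; lra.
rewrite lee_fin lerD2l lerN2 ler_wpM2l//; first by rewrite mulr_ge0// sqr_ge0.
by apply: reject_below; rewrite ler_pdivlMr// mul1r.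
Qed.

Lemma step_le_above (th : R) : 0 <= th <= 1 -> r <= s -> r <= M -> th * s <= M - r ->
  (step <= (a + p r - k * th * (A + r) * s * r * c0 R)%:E)%E.
Proof.
move=> th01 rs rM thM; have /andP[th0 _] := th01.
have c00 : 0 <= k * th * (A + r) by rewrite !mulr_ge0// addr_ge0.
apply: le_trans (step_le_dissipation (i := `[0, 2^-1]) c00 _ _) _.
- move=> v; rewrite in_itv/= => /andP[v1 v2]; rewrite exprn_ile1//; lra.
- move=> v; rewrite in_itv/= => /andP[v1 v2] tv.
  have sv : s * v <= s * 2^-1 by rewrite ler_wpM2l// ltW.
  have sv0 : 0 <= s * v by rewrite mulr_ge0// ltW.
  by apply: (@tangent_defect_right _ _ _ _ _ _ _ th s) => //; lra.
rewrite lee_fin lerD2l lerN2.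
have -> : k * th * (A + r) * s * r * c0 R =
    k * th * (A + r) * s ^+ 2 * (c0 R * (r / s)) by field; rewrite gt_eqF.
rewrite ler_wpM2l//; first by rewrite mulr_ge0// sqr_ge0.
by apply: reject_above; rewrite (divr_ge0 r0 (ltW s0)) ler_pdivrMr// mul1r.
Qed.

Lemma step_le_coalescence : r <= s -> r <= M ->
  (step <= (a + p r - k * A * r ^+ 2 * c0 R)%:E)%E.
Proof.
move=> rs rM.
have rs01 : 0 <= r / s <= 1 by rewrite (divr_ge0 r0 (ltW s0)) ler_pdivrMr// mul1r.
have rs0 := (andP rs01).1.
have := @coupled_cost_bound (fun=> 0) (k * A * r ^+ 2).
have -> : (fun v => 0 * w v) = (fun=> 0) by apply/funext => v; rewrite mul0r.
rewrite gauss_mean_cst subr0 => H.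
apply: le_trans (H _ _ _) _.
- exact: lin_growth_cst.
- by move=> v tv; rewrite subr0; apply: bent_profile_tangent => //; exact: ltW.
- exact: tangent_defect_zero.
rewrite lee_fin [X in _ <= X - _]addrC lerB ?lerD2l//.
  by rewrite ler_piMr// gauss_mean_reject_le1.
by rewrite ler_wpM2l ?c0_le_accept// !mulr_ge0// exprn_ge0.
Qed.

End OneStep.

(** * Constants *)

Lemma bending0 (R : realType) (h M : R) : 0 < h -> 0 < M ->
  bending h M 0 = (2 * (2 * Num.sqrt h * M + M ^+ 2))^-1.
Proof.
move=> h0 M0; have s0 : 0 < Num.sqrt h by rewrite sqrtr_gt0.
rewrite /bending /c_const eqxx (int_ratioE h0 (c0_gt0 R) _ (ltW M0)); last by left.
rewrite add0r; have D0 : 0 < 2 * Num.sqrt h * M + M ^+ 2.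
  by rewrite addr_gt0 ?exprn_gt0// !mulr_gt0.
have c0n := c0_gt0 R.
by field; rewrite !gt_eqF.
Qed.

Lemma bending_pos (R : realType) (h M a : R) : 0 < h -> 0 < M -> Num.sqrt h <= a ->
  bending h M a * (c0 R * h) = Num.min (p0 R / 2)
    (c0 R * h / (2 * (2 * (a + Num.sqrt h) * M + M ^+ 2))).
Proof.
move=> h0 M0 ah; have s0 : 0 < Num.sqrt h by rewrite sqrtr_gt0.
have a0 : 0 < a by apply: lt_le_trans ah.
have c0n := c0_gt0 R.
rewrite /bending /c_const (gt_eqF a0) (int_ratioE h0 c0n _ (ltW M0)); last by right.
rewrite divfK; last by rewrite gt_eqF// mulr_gt0.
congr (Num.min _ _).
have D0 : 0 < 2 * (a + Num.sqrt h) * M + M ^+ 2.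
  by rewrite addr_gt0 ?exprn_gt0// !mulr_gt0// addr_gt0.
by field; rewrite !gt_eqF.
Qed.

(** The second bound says that the slope stays above 1/2: this is the purpose of
    the factor 1/4 in [c_const]. *)
Lemma bending_bounds (R : realType) (h M a : R) :
  0 < h -> 0 < M -> a = 0 \/ Num.sqrt h <= a ->
  0 <= bending h M a /\
  bending h M a * (2 * (a + Num.sqrt h) * M + M ^+ 2) <= 2^-1.
Proof.
move=> h0 M0 ah; have s0 : 0 < Num.sqrt h by rewrite sqrtr_gt0.
have a0 : 0 <= a by case: ah => [->//|]; apply: le_trans; exact: ltW.
have D0 : 0 < 2 * (a + Num.sqrt h) * M + M ^+ 2.
  by rewrite addr_gt0 ?exprn_gt0// !mulr_gt0// ltr_wpDl.
case: ah D0 => [->|ah] D0.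
  rewrite bending0// add0r; rewrite add0r in D0; split.
    by rewrite invr_ge0 mulr_ge0// ltW.
  by rewrite invfM mulfVK// gt_eqF.
have ch0 : 0 < c0 R * h by rewrite mulr_gt0// c0_gt0.
have e := bending_pos h0 M0 ah; split.
  rewrite -(pmulr_lge0 _ ch0) e le_min; apply/andP; split.
    by rewrite divr_ge0// p0_ge0.
  by rewrite divr_ge0 ?ltW// mulr_gt0.
rewrite -(ler_pM2r ch0) mulrAC e.
apply: (@le_trans _ _ (c0 R * h / (2 * (2 * (a + Num.sqrt h) * M + M ^+ 2)) *
  (2 * (a + Num.sqrt h) * M + M ^+ 2))).
  by rewrite ler_pM2r// ge_min lexx orbT.
rewrite le_eqVlt; apply/orP; left; apply/eqP.
by field; rewrite gt_eqF.
Qed.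

Lemma c1_ge0 (R : realType) (h K M a : R) : 0 < h -> 0 < K -> 0 < M -> 0 <= a ->
  0 <= c1 h K M a.
Proof.
move=> h0 K0 M0 a0; have s0 : 0 <= Num.sqrt h by rewrite sqrtr_ge0.
have c00 := ltW (c0_gt0 R); have p00 := p0_ge0 R.
have [[h0' K0'] M0'] := (ltW h0, ltW K0, ltW M0).
have sM : 0 <= Num.sqrt h * M by rewrite mulr_ge0.
have aM : 0 <= a * M by rewrite mulr_ge0.
have M2 := sqr_ge0 M.
have D1 : 0 <= M ^+ 2 + 2 * Num.sqrt h * M + 12 * h by lra.
have D2 : 0 <= M ^+ 2 + 2 * (a + Num.sqrt h) * M by lra.
have c00' : 0 <= 2 * c0 R by rewrite mulr_ge0.
have p00' : 0 <= 2 * p0 R by rewrite mulr_ge0.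
rewrite /c1; case: ifP => _; rewrite mulr_ge0// !le_min.
  by rewrite K0' divr_ge0.
by rewrite (divr_ge0 c00' D2) (divr_ge0 p00' h0') divr_ge0// addr_ge0// divr_ge0.
Qed.

Lemma c1_le_drift (R : realType) (h K M a : R) : 0 < h ->
  c1 h K M a * h <= K * h / 4 / (1 + a / M).
Proof.
move=> h0; rewrite (_ : K * h / 4 / (1 + a / M) = 4^-1 * (K / (1 + a / M)) * h); last by ring.
rewrite ler_pM2r// /c1; case: ifP => [/eqP ->|_].
  by rewrite mul0r addr0 divr1 ler_pM2l// ge_min lexx.
by rewrite ler_pM2l// ge_min lexx.
Qed.

Lemma c1_le_diffusion0 (R : realType) (h K M : R) : 0 < h -> 0 < M ->
  c1 h K M 0 * h <=
  c0 R * h / (2 * (2 * Num.sqrt h * M + M ^+ 2 + 12 * h)).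
Proof.
move=> h0 M0; have s0 : 0 <= Num.sqrt h by rewrite sqrtr_ge0.
have D0 : 0 < M ^+ 2 + 2 * Num.sqrt h * M + 12 * h.
  by rewrite ltr_wpDl ?mulr_gt0// addr_ge0 ?sqr_ge0// !mulr_ge0// ltW.
rewrite /c1 eqxx.
apply: (@le_trans _ _ (4^-1 * (2 * c0 R /
    (M ^+ 2 + 2 * Num.sqrt h * M + 12 * h)) * h)).
  by rewrite ler_pM2r// ler_pM2l// ge_min lexx orbT.
rewrite le_eqVlt; apply/orP; left; apply/eqP.
rewrite [2 * _ * M + _]addrC.
by field; rewrite gt_eqF.
Qed.

Lemma c1_le_pos (R : realType) (h K M a : R) : 0 < h -> 0 < M -> Num.sqrt h <= a ->
  c1 h K M a * h <= bending h M a * (c0 R * h).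
Proof.
move=> h0 M0 ah; have s0 : 0 < Num.sqrt h by rewrite sqrtr_gt0.
have a0 : 0 < a by apply: lt_le_trans ah.
rewrite bending_pos// le_min /c1 (gt_eqF a0); apply/andP; split.
  apply: (@le_trans _ _ (4^-1 * (2 * p0 R / h) * h)).
    by rewrite ler_pM2r// ler_pM2l// !ge_min lexx !orbT.
  by rewrite le_eqVlt; apply/orP; left; apply/eqP; field; rewrite gt_eqF.
have D0 : 0 < M ^+ 2 + 2 * (a + Num.sqrt h) * M.
  by rewrite addr_gt0 ?exprn_gt0// !mulr_gt0// addr_gt0.
apply: (@le_trans _ _ (4^-1 * (2 * c0 R / (M ^+ 2 + 2 * (a + Num.sqrt h) * M)) * h)).
  by rewrite ler_pM2r// ler_pM2l// !ge_min lexx !orbT.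
rewrite le_eqVlt; apply/orP; left; apply/eqP; rewrite [2 * _ * M + _]addrC.
by field; rewrite gt_eqF.
Qed.

Lemma c0_le1 (R : realType) : c0 R <= 1.
Proof.
have := @c0_le_accept R 0; rewrite lexx ler01 => /(_ isT).
have := gauss_mean_ge0 (@reject_ge0 R 0); lra.
Qed.

Lemma c1_le_half (R : realType) (h K M a : R) :
  0 < h -> 0 < M -> a = 0 \/ Num.sqrt h <= a -> c1 h K M a * h <= 2^-1.
Proof.
move=> h0 M0 [->|ah].
  apply: le_trans (c1_le_diffusion0 _ h0 M0) _.
  have s0 : 0 <= Num.sqrt h by rewrite sqrtr_ge0.
  have D0 : 0 <= 2 * Num.sqrt h * M + M ^+ 2.
    by rewrite addr_ge0 ?sqr_ge0// !mulr_ge0// ltW.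
  rewrite ler_pdivrMr; last by rewrite mulr_gt0// ltr_wpDl// mulr_gt0.
  have : c0 R * h <= 1 * h by rewrite ler_pM2r// c0_le1.
  by lra.
apply: le_trans (c1_le_pos _ h0 M0 ah) _.
rewrite bending_pos// ge_min; apply/orP; left.
by have := p0_le1 R; lra.
Qed.

Lemma c1_le_bending (R : realType) (h K M a : R) :
  0 < h -> 0 < M -> a = 0 \/ Num.sqrt h <= a ->
  c1 h K M a * h <= bending h M a * (c0 R * h).
Proof.
move=> h0 M0 [->|ah]; last exact: c1_le_pos.
apply: le_trans (c1_le_diffusion0 _ h0 M0) _.
have s0 : 0 < Num.sqrt h by rewrite sqrtr_gt0.
have D0 : 0 < 2 * Num.sqrt h * M + M ^+ 2.
  by rewrite addr_gt0 ?exprn_gt0// !mulr_gt0.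
rewrite bending0// [leRHS]mulrC ler_pM2l; last by rewrite mulr_gt0// c0_gt0.
by rewrite lef_pV2 ?posrE ?mulr_gt0 ?addr_gt0 ?mulr_gt0 ?exprn_gt0//; lra.
Qed.

(** In this range the term [12 * h] dominates the denominator of [c1]. *)
Lemma c1_le_short_range (R : realType) (h K M : R) :
  0 < h -> 0 < M -> M <= 2 * Num.sqrt h ->
  c1 h K M 0 * h <= bending h M 0 * Num.sqrt h * (M / 2) * c0 R.
Proof.
move=> h0 M0 Ms; apply: le_trans (c1_le_diffusion0 _ h0 M0) _.
have s0 : 0 < Num.sqrt h by rewrite sqrtr_gt0.
rewrite bending0//; set s := Num.sqrt h in s0 Ms *.
have hE : h = s ^+ 2 by rewrite sqr_sqrtr// ltW.
have c00 := c0_gt0 R.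
set D := 2 * s * M + M ^+ 2.
have sM : 0 < s * M by rewrite mulr_gt0.
have s2 : 0 < s ^+ 2 by rewrite exprn_gt0.
have D0 : 0 < D by rewrite /D; have := sqr_ge0 M; lra.
have DM : D <= 4 * s * M.
  have : M * M <= 2 * s * M by rewrite ler_pM2r.
  by rewrite /D expr2; lra.
rewrite hE ler_pdivrMr; last by lra.
have -> : (2 * D)^-1 * s * (M / 2) * c0 R * (2 * (D + 12 * s ^+ 2)) =
    c0 R * s * (M * (D + 12 * s ^+ 2) / (2 * D)).
  by field; rewrite gt_eqF.
have -> : c0 R * s ^+ 2 = c0 R * s * s by ring.
have cs : 0 < c0 R * s by rewrite mulr_gt0.
have D2 : 0 < 2 * D by rewrite mulr_gt0.
rewrite ler_pM2l// ler_pdivlMr//.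
have : s * D <= s * (4 * s * M) by rewrite ler_pM2l.
have : 0 <= M * D by rewrite mulr_ge0// ltW.
have : 0 <= s * (s * M) by rewrite mulr_ge0// ltW.
by lra.
Qed.

(** * Contraction in one step *)

Section Contraction.
Variables (R : realType) (h K M a r rh : R).
Hypotheses (h0 : 0 < h) (K0 : 0 < K) (M0 : 0 < M).
Hypothesis ah : a = 0 \/ Num.sqrt h <= a.
Hypotheses (rh0 : 0 <= rh) (rhr : rh <= r).
Let s := Num.sqrt h.
Let k := bending h M a.
Let A := a + s.
Let kap := c1 h K M a * h.
Local Notation p := (bent_profile k A M).
Local Notation step := (\int[lebesgue_measure]_v
  (cost a k A M `|rh + 2 * s * v| * reject (rh / s) v * normal_pdf 0 1 v)%:E)%E.

(** The gain is [kap * (a + rh)] in each regime of the ratio of [rh] to the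
    noise level [s]. *)
Lemma step_near_diagonal : rh <= M -> (step <= (a + p rh - kap * (a + rh))%:E)%E.
Proof.
move=> rM.
have s0 : 0 < s by rewrite sqrtr_gt0.
have a0 : 0 <= a by case: ah => [->//|]; apply: le_trans; exact: ltW.
have A0 : 0 <= A by rewrite addr_ge0// ltW.
have [k0 kM] := bending_bounds h0 M0 ah; rewrite -/k -/s -/A in k0 kM.
have hE : h = s ^+ 2 by rewrite sqr_sqrtr// ltW.
have c00 := c0_gt0 R.
have kap0 : 0 <= kap by rewrite mulr_ge0 ?(ltW h0)// c1_ge0.
have [rs|sr] := leP rh s; last first.
  have H : (step <= (a + p rh - k * (A - s + rh) * s ^+ 2 * c0 R)%:E)%E.
    by apply: step_le_below => //; rewrite ?(ltW s0) ?(ltW sr)//= lerDr.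
  apply: le_trans H _; rewrite lee_fin lerD2l lerN2.
  have -> : k * (A - s + rh) * s ^+ 2 * c0 R = k * (c0 R * h) * (a + rh).
    by rewrite /A hE; ring.
  apply: ler_wpM2r; first by rewrite addr_ge0.
  exact: c1_le_bending.
have rs01 : 0 <= rh / s <= 1 by rewrite (divr_ge0 rh0 (ltW s0)) ler_pdivrMr// mul1r.
(* A metric with an atom of size at least [s] gains from coalescence alone. *)
case: (ah) => [a00|sa]; last first.
  apply: le_trans (step_le k0 A0 M0 kM a0 s0 rh0) _; rewrite lee_fin.
  have kp : kap <= p0 R / 2.
    by apply: le_trans (c1_le_pos _ h0 M0 sa) _; rewrite bending_pos// ge_min lexx.
  have : a * gauss_mean (reject (rh / s)) <= a * (1 - p0 R).
    by apply: ler_wpM2l => //; have := p0_le_accept rs01; lra.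
  have : kap * (a + rh) <= p0 R / 2 * (2 * a).
    by apply: ler_pM => //; [rewrite addr_ge0|have := le_trans rs sa; lra].
  by lra.
have AE : A = s by rewrite /A a00 add0r.
have short : M <= 2 * s -> kap * rh <= k * s * (M / 2) * c0 R * rh.
  by move=> Ms; apply: ler_wpM2r => //; rewrite /kap /k a00; exact: c1_le_short_range.
(* Does the excursion of length [s] to the right of [rh] stay where the profile
   bends? *)
have [sM|Ms] := leP s (M - rh).
  have H : (step <= (a + p rh - k * 1 * (A + rh) * s * rh * c0 R)%:E)%E.
    by apply: step_le_above => //; rewrite ?mul1r// ler01 lexx.
  apply: le_trans H _; rewrite lee_fin lerD2l lerN2 a00 add0r.
  apply: (@le_trans _ _ (k * (c0 R * h) * rh)).
    by apply: ler_wpM2r => //; exact: c1_le_bending.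
  have -> : k * 1 * (A + rh) * s * rh * c0 R =
     k * (c0 R * h) * rh + k * (c0 R * s * rh ^+ 2) by rewrite AE hE; ring.
  by rewrite lerDl mulr_ge0// mulr_ge0 ?sqr_ge0// mulr_ge0// ltW.
have M2s : M <= 2 * s by lra.
have ks : 0 <= k * s by rewrite mulr_ge0// ltW.
(* The bend is shorter than the excursion; compare the parts of it on the two
   sides of [rh]. *)
have [rM2|rM2] := leP rh (M / 2).
  have H : (step <= (a + p rh - k * ((M - rh) / s) * (A + rh) * s * rh * c0 R)%:E)%E.
    apply: step_le_above => //; last by rewrite divfK// gt_eqF.
    by rewrite ler_pdivrMr// mul1r (ltW Ms) divr_ge0 ?subr_ge0// ltW.
  apply: le_trans H _; rewrite lee_fin lerD2l lerN2 a00 add0r.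
  apply: le_trans (short M2s) _.
  have -> : k * ((M - rh) / s) * (A + rh) * s * rh * c0 R =
     (k * (s + rh)) * (M - rh) * c0 R * rh by rewrite AE; field; rewrite gt_eqF.
  rewrite ler_wpM2r// ler_wpM2r ?(ltW c00)//; apply: ler_pM => //.
  - by rewrite divr_ge0// ltW.
  - by rewrite ler_wpM2l// lerDl.
  - by lra.
have H : (step <= (a + p rh - k * A * rh ^+ 2 * c0 R)%:E)%E by exact: step_le_coalescence.
apply: le_trans H _; rewrite lee_fin lerD2l lerN2 a00 add0r.
apply: le_trans (short M2s) _.
have -> : k * A * rh ^+ 2 * c0 R = k * s * rh * c0 R * rh by rewrite AE; ring.
by rewrite ler_wpM2r// ler_wpM2r ?(ltW c00)// ler_wpM2l// ltW.
Qed.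

(** The gain at [rh] is transported to [r] at the expense of the slope 1/2 of
    the profile, since [kap <= 1/2]. *)
Lemma step_contraction : 0 < r -> (M <= r -> rh <= (1 - h * K / 2) * r) ->
  (step <= ((1 - kap) * (a + p r))%:E)%E.
Proof.
move=> r0 drift.
have s0 : 0 < s by rewrite sqrtr_gt0.
have a0 : 0 <= a by case: ah => [->//|]; apply: le_trans; exact: ltW.
have A0 : 0 <= A by rewrite addr_ge0// ltW.
have [k0 kM] := bending_bounds h0 M0 ah; rewrite -/k -/s -/A in k0 kM.
have kap0 : 0 <= kap by rewrite mulr_ge0 ?(ltW h0)// c1_ge0.
have kap2 : kap <= 2^-1 by exact: c1_le_half.
have /andP[inc _] := bent_profile_increment k0 A0 M0 kM rh0 rhr.
have /andP[_ pr] := bent_profile_bounds k0 A0 M0 kM (ltW r0).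
have kpr : kap * (a + p r) <= kap * (a + r) by rewrite ler_wpM2l// lerD2l.
have [Mr|rM] := leP M r.
  have rs0 : 0 <= rh / s by rewrite (divr_ge0 rh0 (ltW s0)).
  apply: le_trans (step_le k0 A0 M0 kM a0 s0 rh0) _; rewrite lee_fin.
  have aW : a * gauss_mean (reject (rh / s)) <= a.
    by rewrite ler_piMr// gauss_mean_reject_le1.
  have aM : 0 < 1 + a / M by rewrite ltr_wpDr// divr_ge0// ltW.
  have : kap * (a + r) <= K * h / 4 * r.
    apply: (@le_trans _ _ (K * h / 4 / (1 + a / M) * (a + r))).
      by rewrite ler_wpM2r ?c1_le_drift// addr_ge0// ltW.
    rewrite -!mulrA !ler_pM2l// mulrC ler_pdivrMr// mulrDr mulr1 addrC lerD2l.
    by rewrite mulrCA ler_peMr// ler_pdivlMr// mul1r.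
  have := drift Mr; lra.
apply: le_trans (step_near_diagonal (ltW (le_lt_trans rhr rM))) _; rewrite lee_fin.
have : kap * (r - rh) <= 2^-1 * (r - rh) by rewrite ler_wpM2r// subr_ge0.
by lra.
Qed.

End Contraction.

(** * The Euler scheme *)

(** Expanding the square, the drift gains [2 * h * K] and the second order term
    costs [h ^+ 2 * L ^+ 2 <= h * K], by the choice of [h0]. *)
Lemma euler_contraction (R : realType) (d : nat) (b : 'cV[R]_d -> 'cV[R]_d)
    (h K L : R) (x y : 'cV[R]_d) :
  0 < h -> 0 < K -> 0 < L -> h < h0 K L -> x != y ->
  dotp (x - y) (b x - b y) <= - K * enorm (x - y) ^+ 2 ->
  enorm (b x - b y) <= L * enorm (x - y) ->
  enorm (euler h b x - euler h b y) <= (1 - h * K / 2) * enorm (x - y).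
Proof.
move=> h_gt0 K0 L0 hh0 xy drift lip.
set r := enorm (x - y) in drift lip *.
have r0 : 0 < r by rewrite lt_neqAle enorm_ge0 eq_sym enorm_eq0 subr_eq0 xy.
have hLK : h * L ^+ 2 <= K.
  have : h <= L^-1 * (K / L).
    by apply: le_trans (ltW hh0) _; rewrite ler_pM2l ?invr_gt0// ge_min lexx.
  have L2 : 0 < L ^+ 2 by rewrite exprn_gt0.
  rewrite -(ler_pM2r L2); have -> : L^-1 * (K / L) * L ^+ 2 = K.
    by field; rewrite gt_eqF.
  by [].
have e : euler h b x - euler h b y = (x - y) + h *: (b x - b y).
  by rewrite /euler opprD addrACA scalerBr.
have sq : enorm (euler h b x - euler h b y) ^+ 2 <= r ^+ 2 * (1 - h * K).
  rewrite e; move: (x - y) (b x - b y) @r r0 drift lip {e} => u q r r0 drift lip.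
  rewrite enorm_sqr !(dotpDl, dotpDr, dotpZl, dotpZr) (dotpC q u) -!enorm_sqr -/r.
  have h1 : h * dotp u q <= h * (- K * r ^+ 2) by rewrite ler_pM2l.
  have h2 : enorm q ^+ 2 <= (L * r) ^+ 2.
    by rewrite lerXn2r// nnegrE ?enorm_ge0// mulr_ge0// ltW.
  have h3 : h * (h * enorm q ^+ 2) <= h * (h * (L * r) ^+ 2).
    by rewrite !ler_pM2l.
  have h4 : h * r ^+ 2 * (h * L ^+ 2) <= h * r ^+ 2 * K.
    by rewrite ler_wpM2l// mulr_ge0 ?sqr_ge0// ltW.
  by rewrite exprMn in h3; lra.
have hK : 0 <= 1 - h * K.
  have : 0 <= r ^+ 2 * (1 - h * K) by apply: le_trans sq; exact: sqr_ge0.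
  by rewrite pmulr_rge0// exprn_gt0.
have hK2 : 0 <= 1 - h * K / 2 by lra.
rewrite -(@ler_pXn2r _ 2)// ?nnegrE ?enorm_ge0//; last by rewrite mulr_ge0// ltW.
apply: le_trans sq _; rewrite exprMn [leRHS]mulrC ler_pM2l ?exprn_gt0//.
by have := sqr_ge0 (h * K / 2); lra.
Qed.

Theorem theorem2p8 (R : realType) (d : nat) (b : 'cV[R]_d -> 'cV[R]_d)
    (h J K L calR a : R)
    (h_gt0 : 0 < h) (J_ge0 : 0 <= J) (K_gt0 : 0 < K) (L_gt0 : 0 < L)
    (calR_gt0 : 0 < calR)
    (C1 : forall x y : 'cV[R]_d,
      dotp (x - y) (b x - b y) <= J * enorm (x - y) ^+ 2)
    (C2 : forall x y : 'cV[R]_d, calR <= enorm (x - y) ->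
      dotp (x - y) (b x - b y) <= - K * enorm (x - y) ^+ 2)
    (C3 : forall x y : 'cV[R]_d, enorm (b x - b y) <= L * enorm (x - y))
    (euler_nonexp : forall x y : 'cV[R]_d,
      enorm (euler h b x - euler h b y) <= enorm (x - y))
    (a_cond : a = 0 \/ Num.sqrt h <= a) :
  [/\ g_fun h calR a 0 = 1,
      forall s : R, 0 <= s <= calR -> 2^-1 <= g_fun h calR a s <= 1,
      forall x y : 'cV[R]_d,
        a * (x != y)%:R + 2^-1 * enorm (x - y) <= rho h calR a x y
        /\ rho h calR a x y <= a * (x != y)%:R + enorm (x - y)
    & h < h0 K L ->
      forall (disp : measure_display) (T : measurableType disp)
        (P : probability T R) (Z : {RV P >-> d.-tuple R}) (U : {RV P >-> R}),
      std_gaussian Z -> uniform01 U -> independent_RVs Z U ->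
      forall x y : 'cV[R]_d,
        ('E_P[fun w : T => rho h calR a
                (couplingX h b x (cvec (Z w)))
                (couplingY h b x y (cvec (Z w)) (U w))]
         <= ((1 - c1 h K calR a * h) * rho h calR a x y)%:E)%E].
Proof.
have s0 : 0 < Num.sqrt h by rewrite sqrtr_gt0.
have a0 : 0 <= a by case: a_cond => [->//|]; apply: le_trans; exact: ltW.
have A0 : 0 <= a + Num.sqrt h by rewrite addr_ge0// ltW.
have [k0 kM] := bending_bounds h_gt0 calR_gt0 a_cond.
have gE := g_funE h_gt0 (c0_gt0 R) a_cond.
split.
- rewrite gE ?lexx ?ltW// bent_slope_small ?ltW// expr0n /=; ring.
- move=> s sM; rewrite gE//; apply: bent_slope_bounds => //.
  by case/andP: sM.
- move=> x y; rewrite /rho.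
  rewrite (f_funE h_gt0 (c0_gt0 R) a_cond (ltW calR_gt0) (enorm_ge0 _)).
  have /andP[lo up] := bent_profile_bounds k0 A0 calR_gt0 kM (enorm_ge0 (x - y)).
  by rewrite !lerD2l mulrC.
move=> hh0 disp T P Z U gZ uU iZU x y.
have -> : (fun w : T => rho h calR a (couplingX h b x (cvec (Z w)))
    (couplingY h b x y (cvec (Z w)) (U w))) =
  (fun w => cost a (bending h calR a) (a + Num.sqrt h) calR
    (enorm (couplingX h b x (cvec (Z w)) - couplingY h b x y (cvec (Z w)) (U w)))).
  by apply/funext => w; rewrite rhoE.
rewrite rhoE//; set r := enorm (x - y).
have cost0' u : 0 <= cost a (bending h calR a) (a + Num.sqrt h) calR u by exact: cost_ge0.
(* If the Euler points agree, the chains meet surely, and only the sign of the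
   contraction factor matters. *)
have [exy|exy] := eqVneq (euler h b x) (euler h b y).
  have -> : (fun w => cost a (bending h calR a) (a + Num.sqrt h) calR
      (enorm (couplingX h b x (cvec (Z w)) -
        couplingY h b x y (cvec (Z w)) (U w)))) = cst 0.
    apply/funext => w; rewrite coupling_distance// exy subrr enorm0.
    rewrite /unit_dir eqxx /= /dotp trmx0 mul0mx mxE mulr0 addr0 normr0.
    by case: ifP => _; exact: cost0.
  rewrite expectation_cst lee_fin mulr_ge0//.
  by have := c1_le_half K h_gt0 calR_gt0 a_cond; lra.
have xy : x != y by apply: contraNneq exy => ->.
have r0 : 0 < r by rewrite lt_neqAle enorm_ge0 eq_sym enorm_eq0 subr_eq0 xy.
rewrite (expectation_coupling h_gt0 gZ uU iZU exy (cost0 _ _ _ _) cost0'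
  (measurable_cost _ _ _ _)).
rewrite (cost_pos _ _ _ _ r0).
set rh := enorm (euler h b x - euler h b y).
have rh0 : 0 <= rh by exact: enorm_ge0.
have drift : calR <= r -> rh <= (1 - h * K / 2) * r.
  by move=> Mr; apply: (euler_contraction h_gt0 K_gt0 L_gt0 hh0 xy); [exact: C2|exact: C3].
apply: le_trans (step_contraction h_gt0 K_gt0 calR_gt0 a_cond rh0 (euler_nonexp x y) r0 drift).
rewrite le_eqVlt; apply/orP; left; apply/eqP; apply: eq_integral => v _.
congr (_ * _ * _)%:E; rewrite /reject; congr (Num.max 0 (1 - expR _)).
have hE : h = Num.sqrt h ^+ 2 by rewrite sqr_sqrtr// ltW.
set s := Num.sqrt h in s0 hE *.
by rewrite hE; field; rewrite gt_eqF.
Qed.
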